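(* Let $\Omega\subset\mathbb{R}^N$ be convex and let $M$ be a minimal two-phase partitioning of $\Omega$. Assume that the following condition holds: for all sufficiently large $\sigma$ there is a convex set $\Omega_\sigma$ containing $M$ such that $\Omega_\sigma$ contacts $\Sigma=\partial\Omega$ along $\partial M$, i.e. $T_p\partial\Omega_\sigma=T_p\Sigma$ at all $p\in\partial M$, and $$II_{\partial\Omega_\sigma,p}(N_p,N_p)\geqslant\sigma,\qquad p\in\partial M,$$ where $N_p$ is the unit normal of $M$ at $p$. Then there is a convex set $\Omega^\star$ for which $M$ is an unstable partitioning.
   Context: $\Omega$ is a bounded domain with boundary $\Sigma$. $M$ is a $C^2$ hypersurface with $C^2$ boundary $\partial M\subset\Sigma$, dividing $\Omega$ into two phases; it is minimal if the first variation of its area vanishes for all variations preserving $\Sigma$ and the volume of the phases. $II_{\partial\Omega'}(u,v)=\langle N_{\partial\Omega'},D_uv\rangle$ is the second fundamental form of $\partial\Omega'$, with $N_{\partial\Omega'}$ the inward unit normal (so that it is nonnegative for convex $\Omega'$). For a convex set $\Omega'$ in which $M$ is a partitioning, the second variation of area for a normal variation with normal component $f$ is $$J_{\Omega'}(f)=\int_M\left(|\nabla^Mf|^2-|B_M|^2f^2\right)-\int_{\partial M}II_{\partial\Omega'}(N,N)f^2,$$ where $\nabla^M$ is the gradient on $M$, $N$ its unit normal field and $|B_M|$ the norm of its second fundamental form. $M$ is an unstable partitioning of $\Omega'$ if $J_{\Omega'}(f)<0$ for some admissible $f$, where admissibility includes the volume constraint $\int_Mf=0$. *)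

(* Defs.v *)
From HB Require Import structures.
From mathcomp Require Import all_boot all_order all_algebra.
From mathcomp Require Import all_classical all_reals all_analysis.

Set Implicit Arguments.
Unset Strict Implicit.
Unset Printing Implicit Defensive.

Import Order.TTheory GRing.Theory Num.Theory.
Import numFieldNormedType.Exports.

Local Open Scope classical_set_scope.
Local Open Scope ring_scope.

Section Euclidean.
Context {R : realType} {N : nat}.
Implicit Types (u v nu : 'rV[R]_N).

Definition dot u v : R := \sum_i u 0 i * v 0 i.

(* The library norm on 'rV[R]_N is the sup norm (same topology). *)
Definition enorm u : R := Num.sqrt (dot u u).

(* Orthogonal projection onto the hyperplane nu^\perp, for nu a unit vector. *)
Definition tproj nu u : 'rV[R]_N := u - dot u nu *: nu.

Definition grad (f : 'rV[R]_N -> R) (x : 'rV[R]_N) : 'rV[R]_N :=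
  \row_i 'D_(delta_mx 0 i) f x.

End Euclidean.

(* f is of class C^k on the open set U. *)
Fixpoint Ck (R : realType) (V W : normedModType R) (k : nat) (U : set V)
    (f : V -> W) : Prop :=
  match k with
  | 0%N => forall x, U x -> {for x, continuous f}
  | k'.+1 => (forall x, U x -> differentiable f x) /\
             (forall v, Ck k' U ('D_v f))
  end.

Section Hausdorff.
Context {R : realType} {N : nat}.
Local Notation E := 'rV[R]_N.
Implicit Types (A : set E) (F : (set E)^nat) (d : nat) (delta : R).

(* Volume of the unit ball of R^d. *)
Fixpoint ball_volume d : R :=
  match d with
  | 0%N => 1
  | 1%N => 2
  | d'.+2 => 2 * pi / d'.+2%:R * ball_volume d'
  end.

Definition diam A : \bar R :=
  ereal_sup [set (enorm (z.1 - z.2))%:E | z in A `*` A].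

Definition hgauge d delta A : \bar R :=
  if A == set0 then 0%E
  else if (diam A <= delta%:E)%E
       then (ball_volume d * (fine (diam A) / 2) ^+ d)%:E
       else +oo%E.

Definition hcontent d delta A : \bar R :=
  ereal_inf [set (\sum_(k <oo) hgauge d delta (F k))%E |
              F in [set F | A `<=` \bigcup_k F k]].

(* d-dimensional Hausdorff (outer) measure, normalised so that it is the
   d-dimensional area on d-dimensional C^1 submanifolds (for d = N, Lebesgue
   measure; for d = 0, the counting measure). *)
Definition hausdorff d A : \bar R :=
  ereal_sup [set hcontent d delta A | delta in [set delta | 0 < delta]].

Lemma ball_volume_ge0 d : 0 <= ball_volume d.
Proof.
suff: (0 <= ball_volume d) && (0 <= ball_volume d.+1) by case/andP.
elim: d => [|d /andP[h0 h1]]; first by rewrite /= ler01 ler0n.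
rewrite h1 /= mulr_ge0// divr_ge0 ?ler0n// mulr_ge0 ?ler0n//.
exact: pi_ge0.
Qed.

Lemma hgauge_ge0 d delta A : (0 <= hgauge d delta A)%E.
Proof.
rewrite /hgauge; case: ifPn => // A0; case: ifPn => // _.
rewrite lee_fin mulr_ge0 ?ball_volume_ge0// exprn_ge0// divr_ge0//.
apply: fine_ge0; have /set0P[x Ax] := A0.
apply: (@le_trans _ _ (enorm (x - x))%:E); first by rewrite lee_fin sqrtr_ge0.
by apply: ereal_sup_ubound; exists (x, x).
Qed.

Lemma hgauge0 d delta : hgauge d delta set0 = 0%E.
Proof. by rewrite /hgauge eqxx. Qed.

Local Notation P := (g_sigma_algebraType [set: set E]).

Lemma hcontentE d delta :
  hcontent d delta = @mu_ext _ P R (hgauge d delta) :> (set E -> \bar R).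
Proof.
apply/funext => A; rewrite /hcontent /mu_ext; congr (ereal_inf _).
apply/seteqP; split => _ [F FA <-]; exists F => //; last by case: FA.
by split => // i; apply: sub_gen_smallest.
Qed.

Lemma hcontent_ge0 d delta A : (0 <= hcontent d delta A)%E.
Proof. by rewrite hcontentE; apply: mu_ext_ge0 => X; exact: hgauge_ge0. Qed.

Lemma hausdorff_ge0 d A : (0 <= hausdorff d A)%E.
Proof.
apply: (le_trans (hcontent_ge0 d 1 A)).
by apply: ereal_sup_ubound; exists 1 => //=.
Qed.

Lemma hausdorff0 d : hausdorff d set0 = 0%E.
Proof.
apply/eqP; rewrite eq_le hausdorff_ge0 andbT.
apply: ge_ereal_sup => _ [delta _ <-].
rewrite hcontentE (_ : mu_ext _ _ = 0%E)//.
by apply: mu_ext0 => [|X]; [exact: hgauge0|exact: hgauge_ge0].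
Qed.

Lemma le_hausdorff d :
  {homo hausdorff d : A B / A `<=` B >-> (A <= B)%E}.
Proof.
move=> A B AB; apply: ge_ereal_sup => _ [delta delta0 <-].
apply: (@le_trans _ _ (hcontent d delta B)).
  by rewrite hcontentE; exact: le_mu_ext.
by apply: ereal_sup_ubound; exists delta.
Qed.

Lemma hausdorff_sigma_subadditive d : sigma_subadditive (hausdorff d).
Proof.
move=> F; apply: ge_ereal_sup => _ [delta delta0 <-].
apply: (@le_trans _ _ (\sum_(i <oo) hcontent d delta (F i))%E).
  rewrite hcontentE.
  by apply: (@mu_ext_sigma_subadditive _ P) => X; exact: hgauge_ge0.
apply: lee_nneseries => [i _ _|i _]; first exact: hcontent_ge0.
by apply: ereal_sup_ubound; exists delta.
Qed.

HB.instance Definition _ d := isOuterMeasure.Build R E (hausdorff d)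
  (hausdorff0 d) (@hausdorff_ge0 d) (@le_hausdorff d)
  (@hausdorff_sigma_subadditive d).

Definition houter d : {outer_measure set E -> \bar R} := hausdorff d.

(* The measure on the Caratheodory sigma-algebra of [hausdorff d] (which
   contains the Borel sets). *)
Definition harea d : {measure set (caratheodory_type (houter d)) -> \bar R} :=
  (houter d : set (caratheodory_type (houter d)) -> \bar R).

End Hausdorff.

Section Geometry.
Context {R : realType} {N : nat}.
Local Notation E := 'rV[R]_N.
Implicit Types (S Omega : set E) (p q u v nu : E).

Definition bd Omega : set E := closure Omega `\` interior Omega.

(* Linear span of the velocities at p of one-sided curves in S. One-sided
   curves make this the full tangent hyperplane also at a boundary point of a
   hypersurface with boundary. *)
Definition velocity S p v := exists2 c : R -> E,
  \forall t \near 0^'+, S (c t) & (t^-1 *: (c t - p)) @[t --> 0^'+] --> v.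

Definition tangent_space S p : set E :=
  [set v | exists (k : nat) (a : 'I_k -> R) (w : 'I_k -> E),
     (forall i, velocity S p (w i)) /\ v = \sum_i a i *: w i].

Definition unit_normal S p nu :=
  enorm nu = 1 /\ forall v, tangent_space S p v -> dot nu v = 0.

Definition unit_normal_field S (nu : E -> E) :=
  {within S, continuous nu} /\ forall p, S p -> unit_normal S p (nu p).

(* V is a C^1 vector field around p which is tangent to S along S. *)
Definition tangent_field_near S p (V : E -> E) :=
  exists U : set E, [/\ open U, U p, Ck 1 U V
    & forall q, U q -> S q -> tangent_space S q (V q)].

(* The second fundamental form <nu, D_u V>, where V is any tangent field with
   V p = v; for a C^2 hypersurface S and u, v in its tangent space at p, such a
   V exists and the value does not depend on it. *)
Definition second_form S nu p u v : R :=
  xget 0 [set k | exists V : E -> E,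
    [/\ tangent_field_near S p V, V p = v & k = dot nu ('D_u V p)]].

Definition inward_normal Omega p : E :=
  xget 0 [set nu | unit_normal (bd Omega) p nu /\
                   \forall t \near 0^'+, Omega (p + t *: nu)].

Definition II_bd Omega p u v : R :=
  second_form (bd Omega) (inward_normal Omega p) p u v.

(* Squared norm of the second fundamental form of S: summing over the projected
   canonical basis gives the Frobenius norm of the form extended by 0 on the
   normal line, i.e. the sum over any orthonormal basis of the tangent space. *)
Definition second_form_sqnorm S (nu : E -> E) p : R :=
  \sum_(i < N) \sum_(j < N)
    second_form S (nu p) p (tproj (nu p) (delta_mx 0 i))
                           (tproj (nu p) (delta_mx 0 j)) ^+ 2.

(* A C^2 diffeomorphism phi, with inverse psi, from the open set U onto an open
   set. *)
Definition C2_chart (U : set E) (phi psi : E -> E) :=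
  [/\ open U, open (phi @` U), Ck 2 U phi, Ck 2 (phi @` U) psi
    & forall x, U x -> psi (phi x) = x].

End Geometry.

Section Partitioning.
Context {R : realType} {n : nat}.
(* The ambient space is R^N with N = n + 2 >= 2. *)
Local Notation E := 'rV[R]_n.+2.
Implicit Types (Omega M bM D S : set E) (nu : E -> E).

Definition C2_hypersurface_at S (p : E) :=
  exists (U : set E) (phi psi : E -> E), [/\ C2_chart U phi psi, U p
    & forall x, U x -> (S x <-> phi x 0 ord_max = 0)].

Definition C2_hypersurface_with_boundary M bM :=
  [/\ compact M, bM `<=` M,
    forall p, (M `\` bM) p -> exists (U : set E) (phi psi : E -> E),
      [/\ C2_chart U phi psi, U p
        & forall x, U x -> (M x <-> phi x 0 ord_max = 0) /\ ~ bM x]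
  & forall p, bM p -> exists (U : set E) (phi psi : E -> E),
      [/\ C2_chart U phi psi, U p
        & forall x, U x ->
            (M x <-> phi x 0 ord_max = 0 /\ 0 <= phi x 0 ord0) /\
            (bM x <-> phi x 0 ord_max = 0 /\ phi x 0 ord0 = 0)]].

Definition bounded_domain Omega :=
  [/\ open Omega, connected Omega, Omega !=set0 & bounded_set Omega].

Definition two_phases Omega M D1 D2 :=
  [/\ open D1 /\ open D2, D1 !=set0 /\ D2 !=set0, D1 `&` D2 = set0,
      D1 `|` D2 = Omega `\` M
    & M `&` Omega `<=` closure D1 `&` closure D2].

(* M includes its boundary bM. *)
Definition partitioning Omega M bM :=
  [/\ bounded_domain Omega,
      C2_hypersurface_with_boundary M bM /\ bM !=set0,
      M `\` bM `<=` Omega, bM `<=` bd Omega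
    & exists D1 D2, two_phases Omega M D1 D2].

Definition variation Omega D1 D2 (phi : R -> E -> E) :=
  phi 0 = id /\ exists2 e : R, 0 < e &
    Ck 2 [set z : (R * E)%type | `|z.1| < e] (fun z : (R * E)%type => phi z.1 z.2) /\
    forall t, `|t| < e ->
      [/\ bijective (phi t), phi t @` bd Omega = bd Omega,
          hausdorff n.+2 (phi t @` D1) = hausdorff n.+2 D1
        & hausdorff n.+2 (phi t @` D2) = hausdorff n.+2 D2].

Definition minimal_partitioning Omega M bM :=
  partitioning Omega M bM /\
  forall D1 D2 phi, two_phases Omega M D1 D2 -> variation Omega D1 D2 phi ->
    is_derive (0 : R) (1 : R) (fun t : R => fine (hausdorff n.+1 (phi t @` M))) 0.

(* The functions on M are restrictions of functions on the ambient space; the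
   tangential gradient is the tangential part of the ambient one. *)
Definition second_variation Omega M bM nu (f : E -> R) : \bar R :=
  (\int[harea n.+1]_(x in M)
     (enorm (tproj (nu x) (grad f x)) ^+ 2
      - second_form_sqnorm M nu x * f x ^+ 2)%:E
   - \int[harea n]_(x in bM) (II_bd Omega x (nu x) (nu x) * f x ^+ 2)%:E)%E.

Definition admissible M (f : E -> R) :=
  Ck 1 setT f /\ (\int[harea n.+1]_(x in M) (f x)%:E = 0)%E.

Definition unstable_partitioning Omega M bM nu :=
  [/\ partitioning Omega M bM,
      forall p, bM p -> C2_hypersurface_at (bd Omega) p
    & exists2 f, admissible M f & (second_variation Omega M bM nu f < 0)%E].

Definition contacts_along Omega' Omega bM :=
  [/\ bM `<=` bd Omega', bM `<=` bd Omega
    & forall p, bM p -> tangent_space (bd Omega') p = tangent_space (bd Omega) p].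

End Partitioning.

(* Main.v *)
Require Import Defs.
From HB Require Import structures.
From mathcomp Require Import all_boot all_order all_algebra.
From mathcomp Require Import all_classical all_reals all_analysis.
From mathcomp Require Import measurable_realfun.
From mathcomp Require Import ring lra.

(* Fix p in bM and take f = |x - p|^2 - c, with c > 0 the mean of |x - p|^2 over
   M. Then f integrates to 0 over M, and f^2 is bounded below near p, hence on a
   subset of bM of positive n-dimensional measure. The interior part of the
   second variation is bounded above by a constant independent of sigma, because
   M has finite area, while the boundary part is at most -sigma times a fixed
   positive number: a convex set with sigma large enough destabilises M. Two
   points are left. First, this set may be unbounded: it is intersected with a
   large ball, which changes nothing near M. Second, M must also separate it into
   two phases: the phases of Omega are transported along rays. *)

Set Implicit Arguments.
Unset Strict Implicit.
Unset Printing Implicit Defensive.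

Import Order.TTheory GRing.Theory Num.Theory.
Import numFieldNormedType.Exports.

Local Open Scope classical_set_scope.
Local Open Scope ring_scope.

(** * Euclidean norm and sup norm *)

Section EuclideanNorm.
Context {R : realType} {N : nat}.
Implicit Types (u v nu : 'rV[R]_N).

(** The order of choices shapes the argument: the convex set depends on [sigma], so the test
    function, the bound [A] on the interior term and the lower bound [k * b] for the integral of its
    square over [bM] must be fixed from [M] alone. Area is Hausdorff measure, so both bounds on it
    come from the charts: the inverse chart is Lipschitz, which makes the area of [M] finite, and
    the chart itself is Lipschitz, which keeps the measure of [bM] away from 0. The curvature terms
    are selected by [xget], and nothing is known about their measurability. They are therefore only
    compared with constants: the squared norm has a favourable sign and is dropped, and the boundary
    integrand is nonnegative. The new convex set neither contains [Omega] nor lies in it, so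
    restricting the old phases would leave points unlabelled. Convexity of the new set keeps a ray
    towards an interior point of [M] inside it; convexity of [Omega] keeps the ray from leaving and
    re-entering [Omega], so the label is unambiguous. *)

Lemma dot_ge0 u : 0 <= dot u u.
Proof. by apply: sumr_ge0 => i _; rewrite -expr2 sqr_ge0. Qed.

Lemma dotC u v : dot u v = dot v u.
Proof. by apply: eq_bigr => i _; rewrite mulrC. Qed.

Lemma dotDl u v w : dot (u + v) w = dot u w + dot v w.
Proof. by rewrite /dot -big_split; apply: eq_bigr => i _; rewrite mxE mulrDl. Qed.

Lemma dotZl (a : R) u v : dot (a *: u) v = a * dot u v.
Proof. by rewrite /dot mulr_sumr; apply: eq_bigr => i _; rewrite mxE mulrA. Qed.

Lemma coord_le_norm u i : `|u 0 i| <= `|u|.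
Proof. by rewrite [leRHS]mx_normrE; apply/bigmax_geP; right; exists (0, i). Qed.

Lemma norm_le_coord u (c : R) : 0 <= c -> (forall i, `|u 0 i| <= c) -> `|u| <= c.
Proof.
move=> c0 uc; rewrite [leLHS]mx_normrE; apply/bigmax_leP; split => // -[i j] _ /=.
by rewrite (ord1 i).
Qed.

Lemma norm_le_enorm u : `|u| <= enorm u.
Proof.
apply: norm_le_coord; first exact: sqrtr_ge0.
move=> i; rewrite -sqrtr_sqr ler_sqrt ?dot_ge0// /dot (bigD1 i)//= expr2.
by rewrite lerDl sumr_ge0// => j _; rewrite -expr2 sqr_ge0.
Qed.

Lemma dot_le_norm u : dot u u <= N%:R * `|u| ^+ 2.
Proof.
rewrite /dot; apply: (@le_trans _ _ (\sum_(i < N) `|u| ^+ 2)).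
  apply: ler_sum => i _; rewrite -expr2 -real_normK ?num_real//.
  by rewrite ler_sqr ?nnegrE// coord_le_norm.
by rewrite sumr_const card_ord mulr_natl.
Qed.

Lemma enorm_le_norm u : enorm u <= N%:R * `|u|.
Proof.
rewrite -(ger0_norm (x := N%:R * `|u|)) ?mulr_ge0// -sqrtr_sqr ler_sqrt ?sqr_ge0//.
apply: (le_trans (dot_le_norm u)); rewrite exprMn ler_wpM2r ?sqr_ge0//.
by rewrite expr2 -natrM ler_nat; case: (N) => // k; rewrite leq_pmulr.
Qed.

Lemma enorm_tproj nu u : enorm nu = 1 -> enorm (tproj nu u) ^+ 2 <= dot u u.
Proof.
move=> nu1; have nn : dot nu nu = 1.
  by have := sqr_sqrtr (dot_ge0 nu); rewrite -/(enorm nu) nu1 expr1n.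
have -> : enorm (tproj nu u) ^+ 2 = dot u u - dot u nu ^+ 2.
  rewrite sqr_sqrtr ?dot_ge0// /tproj -scaleNr dotDl dotZl !(dotC _ (_ + _)).
  by rewrite !dotDl !dotZl nn (dotC nu u); ring.
by rewrite lerBlDr lerDl sqr_ge0.
Qed.

End EuclideanNorm.

(** * Locality of the boundary geometry *)

Section Locality.
Context {R : realType} {N : nat}.
Local Notation E := 'rV[R]_N.
Implicit Types (S T U W Omega : set E) (p v nu : E).

Lemma bd_setI_open Omega W p : open W -> W p ->
  bd (Omega `&` W) p <-> bd Omega p.
Proof.
move=> oW Wp; have nW : nbhs p W by exact: open_nbhs_nbhs.
have c : closure (Omega `&` W) p <-> closure Omega p.
  split=> [/closureI[]//|cO B nB].
  by have [x [Ox [Bx Wx]]] := cO _ (filterI nB nW); exists x.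
have i : (Omega `&` W)° p <-> Omega° p.
  rewrite interiorI; split=> [[]//|Op]; split => //; exact: nW.
by rewrite /bd /=; split => -[/c ? ?]; split => // /i.
Qed.

(** Having a one-sided velocity at [p] forces the curve to converge to [p], so it is eventually
    inside [W]. *)
Lemma velocity_local S T W p v : open W -> W p -> S `&` W `<=` T ->
  velocity S p v -> velocity T p v.
Proof.
move=> oW Wp ST [c Sc cv]; exists c => //.
have cp : c t @[t --> 0^'+] --> p.
  have h : p + t *: (t^-1 *: (c t - p)) @[t --> 0^'+] --> p + 0 *: v.
    apply: cvgD; first exact: cvg_cst.
    apply: cvgZ cv; exact: cvg_at_right_filter.
  rewrite scale0r addr0 in h; apply: cvg_trans h; apply: near_eq_cvg.
  near=> t; rewrite scalerA divff ?scale1r ?subrKC// gt_eqF//.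
have Wc : \forall t \near 0^'+, W (c t) by apply: cp; exact: open_nbhs_nbhs.
by near=> t; apply: ST; split; near: t.
Unshelve. all: by end_near. Qed.

Lemma tangent_space_local S T W p : open W -> W p ->
  (forall x, W x -> (S x <-> T x)) -> tangent_space S p = tangent_space T p.
Proof.
move=> oW Wp ST; apply/seteqP; split=> v [k [a [w [vw ->]]]]; exists k, a, w; split=> // i.
- by apply: (velocity_local oW Wp _ (vw i)) => x [Sx /ST]; tauto.
- by apply: (velocity_local oW Wp _ (vw i)) => x [Sx /ST]; tauto.
Qed.

Lemma Ck_sub (V W' : normedModType R) k (A B : set V) (f : V -> W') :
  A `<=` B -> Ck k B f -> Ck k A f.
Proof.
move=> AB; elim: k f => [|k IH] f /=; first by move=> h x /AB /h.
by move=> [h1 h2]; split=> [x /AB /h1//|v]; exact/IH/h2.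
Qed.

Lemma tangent_field_near_local S T W p V : open W -> W p ->
  (forall x, W x -> (S x <-> T x)) ->
  tangent_field_near S p V -> tangent_field_near T p V.
Proof.
move=> oW Wp ST [U [oU Up CV tV]]; exists (U `&` W); split=> //.
- exact: openI.
- by apply: Ck_sub CV => x [].
- move=> q [Uq Wq] Tq; rewrite -(tangent_space_local oW Wq ST).
  by apply: tV => //; apply/ST.
Qed.

(** Both the inward normal and the form are values of [xget], so it is enough that the sets of
    candidates coincide, and these depend only on the boundary and the domain near [p]. With [W] a
    large ball, truncation preserves the curvature bound along [bM]. *)
Lemma II_bd_setI_open Omega W p u v : open W -> W p ->
  II_bd (Omega `&` W) p u v = II_bd Omega p u v.
Proof.
move=> oW Wp.
have ST x : W x -> (bd (Omega `&` W) x <-> bd Omega x).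
  by move=> Wx; exact: bd_setI_open.
have -> : II_bd (Omega `&` W) p u v =
    second_form (bd (Omega `&` W)) (inward_normal Omega p) p u v.
  rewrite /II_bd /inward_normal; congr (second_form _ (xget 0 _) _ _ _).
  apply/seteqP; split=> nu /=.
    rewrite /unit_normal (tangent_space_local oW Wp ST) => -[? h]; split=> //.
    by apply: filterS h => t [].
  rewrite /unit_normal (tangent_space_local oW Wp ST) => -[? h]; split=> //.
  have Wt : \forall t \near 0^'+, W (p + t *: nu).
    have : p + t *: nu @[t --> 0^'+] --> p + 0 *: nu.
      apply: cvgD; first exact: cvg_cst.
      by apply: cvgZ; [exact: cvg_at_right_filter|exact: cvg_cst].
    rewrite scale0r addr0; apply; exact: open_nbhs_nbhs.
  by near=> t; split; near: t.
rewrite /II_bd /second_form; congr (xget 0 _).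
apply/seteqP; split=> k [V [tV Vp kE]]; exists V; split=> //.
- exact: (tangent_field_near_local oW Wp ST tV).
- by apply: (tangent_field_near_local oW Wp _ tV) => x /ST; tauto.
Unshelve. all: by end_near. Qed.

End Locality.

Lemma C2_hypersurface_at_local (R : realType) (n : nat)
    (S T W : set 'rV[R]_n.+2) (p : 'rV[R]_n.+2) :
  open W -> W p -> (forall x, W x -> (S x <-> T x)) ->
  C2_hypersurface_at S p -> C2_hypersurface_at T p.
Proof.
move=> oW Wp ST [U [phi [psi [[oU oV Cphi Cpsi K] Up Sphi]]]].
(* The restricted chart needs an open image; this form of it reduces openness to the continuity of
   [psi]. *)
have imE : phi @` (U `&` W) = phi @` U `&` psi @^-1` W.
  apply/seteqP; split=> [_ [x [Ux Wx] <-]|_ [[x Ux <-]]] /=.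
    by split; [exists x|rewrite K].
  by rewrite K// => Wx; exists x.
exists (U `&` W), phi, psi; split=> //.
- split.
  + exact: openI.
  + rewrite imE openE => y [Vy Wy]; apply: filterI; first exact: open_nbhs_nbhs.
    by apply: (differentiable_continuous (Cpsi.1 _ Vy)); exact: open_nbhs_nbhs.
  + by apply: Ck_sub Cphi => x [].
  + by apply: Ck_sub Cpsi; rewrite imE => x [].
  + by move=> x [Ux _]; exact: K.
- by move=> x [Ux Wx]; rewrite -(ST _ Wx); exact: Sphi.
Qed.

(** * Continuously differentiable maps are locally Lipschitz *)

Section LocallyLipschitz.
Context {R : realType} {N m : nat}.
Local Notation E := 'rV[R]_N.
Local Notation F := 'rV[R]_m.

(** The mean value theorem is scalar, so it is applied to each coordinate of [f] along a line. *)
Lemma is_derive_line (f : E -> F) (x v : E) (t : R) (j : 'I_m) :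
  derivable f (x + t *: v) v ->
  is_derive t 1 (fun s => f (x + s *: v) 0 j) (('D_v f (x + t *: v)) 0 j).
Proof.
set z := x + t *: v => df.
have cq : (s^-1 *: ((f \o shift z) (s *: v) - f z)) @[s --> 0^'] --> 'D_v f z by exact: df.
have cj : (s^-1 *: ((fun s => f (x + s *: v) 0 j) \o shift t) (s *: 1) - s^-1 *: f z 0 j)
    @[s --> 0^'] --> ('D_v f z) 0 j.
  have := cvg_comp _ _ cq (@coord_continuous _ _ _ 0 j ('D_v f z)).
  apply: cvg_trans; apply: near_eq_cvg; apply: nearW => s /=.
  rewrite !mxE -scalerBr; congr (_ *: (f _ 0 j - _)).
  have -> : s *: (1 : R) = s by exact: mulr1.
  by rewrite /z scalerDl addrCA.
have {}cj : (s^-1 *: (((fun s => f (x + s *: v) 0 j) \o shift t) (s *: 1) - f z 0 j))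
    @[s --> 0^'] --> ('D_v f z) 0 j.
  by move: cj; apply: cvg_trans; apply: near_eq_cvg; apply: nearW => s /=; rewrite scalerBr.
by split; [apply: cvgP cj|exact: cvg_lim cj].
Qed.

Lemma derive_le_basis (f : E -> F) (z v : E) : differentiable f z ->
  `|'D_v f z| <= (\sum_i `|'D_(delta_mx 0 i) f z|) * `|v|.
Proof.
move=> df; rewrite deriveE// {1}(row_sum_delta v) linear_sum /=.
apply: (le_trans (ler_norm_sum _ _ _)); rewrite mulr_suml; apply: ler_sum => i _.
by rewrite linearZ /= normrZ -deriveE// mulrC ler_wpM2l// coord_le_norm.
Qed.

(** The partial derivatives are continuous at [x0], hence bounded on a ball; balls are convex, so
    the mean value theorem applies on segments. In the sup norm the bound on each coordinate is
    already the bound on the vector. *)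
Lemma C1_locally_lipschitz (U : set E) (f : E -> F) (x0 : E) :
  open U -> U x0 -> Ck 1 U f ->
  exists r L : R, [/\ 0 < r, 0 < L, ball x0 r `<=` U &
    forall x y, ball x0 r x -> ball x0 r y -> `|f x - f y| <= L * `|x - y|].
Proof.
move=> oU Ux0 [df cf].
pose L := \sum_(i < N) (`|'D_(delta_mx 0 i) f x0| + 1).
have L0 : 0 <= L by apply: sumr_ge0 => i _; rewrite addr_ge0.
have : \forall x \near x0, U x /\ forall i,
    `|'D_(delta_mx 0 i) f x| <= `|'D_(delta_mx 0 i) f x0| + 1.
  apply: filterI; first exact: open_nbhs_nbhs.
  apply: (@filter_forall _ _ (fun i x =>
    `|'D_(delta_mx 0 i) f x| <= `|'D_(delta_mx 0 i) f x0| + 1) _ (nbhs_filter x0)) => i.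
  have /cvgr_norm_le := cf (delta_mx 0 i) x0 Ux0; apply.
  by rewrite ltrDl.
(* The added 1 keeps the constant positive even for [N = 0], where [L] is an empty sum. *)
move=> /nbhs_ballP[r /= r0 rU]; exists r, (L + 1); split => //.
- by rewrite ltr_wpDl.
- by move=> x /rU[].
move=> x y rx ry.
have seg (t : R) : 0 <= t -> t <= 1 -> ball x0 r (x + t *: (y - x)).
  move=> t0 t1; move: rx ry; rewrite -!ball_normE /= => rx ry.
  have -> : x0 - (x + t *: (y - x)) = (1 - t) *: (x0 - x) + t *: (x0 - y).
    by rewrite !scalerBr !scalerBl !scale1r; apply/rowP => i; rewrite !mxE; ring.
  apply: (le_lt_trans (ler_normD _ _)); rewrite !normrZ.
  rewrite (ger0_norm t0) ger0_norm ?subr_ge0//.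
  have [->|t0'] := eqVneq t 0; first by rewrite subr0 mul1r mul0r addr0.
  have tp : 0 < t by rewrite lt_neqAle eq_sym t0'.
  nra.
have dl : forall z, ball x0 r z -> `|'D_(y - x) f z| <= (L + 1) * `|x - y|.
  move=> z /rU[Uz hz]; apply: (le_trans (derive_le_basis _ (df z Uz))).
  rewrite (distrC x y) ler_wpM2r//; apply: (@le_trans _ _ L); last by rewrite lerDl.
  by apply: ler_sum => i _; exact: hz.
apply: norm_le_coord => [|j]; first by rewrite mulr_ge0// addr_ge0.
have hd (t : R) : 0 <= t -> t <= 1 -> is_derive t 1 (fun s => f (x + s *: (y - x)) 0 j)
    (('D_(y - x) f (x + t *: (y - x))) 0 j).
  move=> t0 t1; apply: is_derive_line; apply: diff_derivable; apply: df.
  by have /rU[] := seg t t0 t1.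
have [||c] := MVT_segment (f := fun s => f (x + s *: (y - x)) 0 j)
  (df := fun t => ('D_(y - x) f (x + t *: (y - x))) 0 j) (@ler01 R).
- by move=> t; rewrite in_itv /= => /andP[/ltW t0 /ltW t1]; exact: hd.
- apply: derivable_within_continuous => t; rewrite in_itv /= => /andP[t0 t1].
  by have [] := hd t t0 t1.
rewrite in_itv /= => /andP[c0 c1].
rewrite scale1r scale0r addr0 subrKC subr0 mulr1 => fE.
rewrite !mxE distrC fE; apply: (le_trans (coord_le_norm _ _)).
exact/dl/seg.
Qed.

End LocallyLipschitz.

(** * Transport of the two phases *)

Lemma convex_set_segment (R : realType) (V : lmodType R) (A : set V) (x y : V) (t : R) :
  convex_set A -> A x -> A y -> 0 <= t -> t <= 1 -> A (x + t *: (y - x)).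
Proof.
move=> cA Ax Ay t0 t1.
have t01 : Itv.spec (@Itv.num_sem R) (Itv.Real `[0%Z, 1%Z]) t.
  by apply/andP; split; rewrite ?num_real// in_itv /= t0.
have := cA y x (Itv.mk t01); rewrite !inE => /(_ Ay Ax); congr (A _).
rewrite /conv /= scalerBl scale1r scalerBr addrC -addrA; congr (_ + _).
by rewrite addrC.
Qed.

Lemma separated_open_disjoint (T : topologicalType) (A B : set T) :
  open A -> open B -> A `&` B = set0 -> separated A B.
Proof.
move=> oA oB AB; split; apply/seteqP; split=> // x [].
- move=> cA Bx; have [y [Ay By]] := cA B (open_nbhs_nbhs (conj oB Bx)).
  by have : (A `&` B) y by []; rewrite AB.
- move=> Ax cB; have [y [By Ay]] := cB A (open_nbhs_nbhs (conj oA Ax)).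
  by have : (A `&` B) y by []; rewrite AB.
Qed.

Section TransferPhases.
Context {R : realType} {n : nat}.
Local Notation E := 'rV[R]_n.+2.
Variables (Omega Omega' M bM D1 D2 : set E) (x0 : E).
Hypotheses (cOmega : convex_set Omega) (oOmega : open Omega).
Hypotheses (cOmega' : convex_set Omega') (oOmega' : open Omega').
Hypotheses (clM : closed M) (MOmega : M `\` bM `<=` Omega).
Hypotheses (MOmega' : M `\` bM `<=` Omega') (bMOmega' : bM `&` Omega' = set0).
Hypotheses (Mx0 : (M `\` bM) x0) (phases : two_phases Omega M D1 D2).

Let ray (x : E) (t : R) : E := x0 + t *: (x - x0).

(* The phase of a point of Omega' is read off by moving towards x0 until one
   enters Omega; M is not met on the way, since M lies in Omega up to bM, and
   bM is outside Omega'. *)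
Let phase (D : set E) : set E := [set x | Omega' x /\
  exists s : R, [/\ 0 <= s, s <= 1, D (ray x s) &
    forall t, s <= t -> t <= 1 -> ~ M (ray x t)]].

Let ray1 x : ray x 1 = x.
Proof. by rewrite /ray scale1r subrKC. Qed.

Let ray_cont : continuous (fun z : (R * E)%type => ray z.2 z.1).
Proof.
move=> z; apply: cvgD; first exact: cvg_cst.
apply: cvgZ; first exact: cvg_fst.
by apply: cvgB; [exact: cvg_snd|exact: cvg_cst].
Qed.

Let ray_contl x : continuous (ray x).
Proof.
move=> t; apply: cvgD; first exact: cvg_cst.
by apply: cvgZ; [exact: cvg_id|exact: cvg_cst].
Qed.

Let ray_contr t : continuous (fun x : E => ray x t).
Proof.
move=> x A /(@ray_cont (t, x)) [[B C] [/= Bt Cx] BC].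
by apply: filterS Cx => y Cy; apply: (BC (t, y)); split => //=; exact: nbhs_singleton.
Qed.

Let MI x : M x -> Omega' x -> Omega x.
Proof.
move=> Mx Ox; apply: MOmega; split=> // bMx.
by have : (bM `&` Omega') x by []; rewrite bMOmega'.
Qed.

(** A tube argument: the part of the ray from [s] to 1 is compact and misses the closed set [M], so
    the rays of nearby points miss [M] on the same interval. *)
Let open_phase D : open D -> open (phase D).
Proof.
move=> oD; rewrite openE => x [Ox [s [s0 s1 Ds Ms]]].
have h1 : \forall y \near x, Omega' y by exact: open_nbhs_nbhs.
have h2 : \forall y \near x, D (ray y s) by apply: ray_contr; exact: open_nbhs_nbhs.
have h3 : \forall y \near x, `[s, 1] `<=` (fun t => ~ M (ray y t)).
  have /compact_near_coveringP cov := @segment_compact R s 1.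
  apply: (cov _ (nbhs x) (fun y t => ~ M (ray y t)) (nbhs_filter x)) => t.
  rewrite /= in_itv /= => /andP[st t1].
  have : nbhs (ray x t) (~` M).
    by apply: open_nbhs_nbhs; split; [exact: closed_openC|exact: Ms].
  exact: (@ray_cont (t, x)).
apply: filterS (filterI h1 (filterI h2 h3)) => y [Oy [Dy My]].
split=> //; exists s; split=> // t st t1.
by apply: My; rewrite /= in_itv /= st t1.
Qed.

(** The reason why the new phases are disjoint: between two times in [Omega] the ray stays in
    [Omega] by convexity and misses [M], so it is a connected subset of the union of the disjoint
    open sets [D] and [D']. *)
Let segment_monochrome D D' x s1 s2 : open D -> open D' -> D `&` D' = set0 ->
  D `|` D' = Omega `\` M -> 0 <= s1 -> s1 <= s2 -> s2 <= 1 ->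
  D (ray x s1) -> D' (ray x s2) ->
  (forall t, s1 <= t -> t <= 1 -> ~ M (ray x t)) -> False.
Proof.
move=> oD oD' DD' DU s10 s12 s21 Ds1 Ds2 Ms.
have conn : connected (ray x @` `[s1, s2]).
  apply: connected_continuous_connected; first exact: segment_connected.
  exact/continuous_subspaceT/ray_contl.
have O1 : Omega (ray x s1) by have [] : (Omega `\` M) (ray x s1) by rewrite -DU; left.
have O2 : Omega (ray x s2) by have [] : (Omega `\` M) (ray x s2) by rewrite -DU; right.
have sub : ray x @` `[s1, s2] `<=` D `|` D'.
  rewrite DU => _ [t + <-]; rewrite /= in_itv /= => /andP[t1 t2].
  split; last first.
    by apply: Ms => //; exact: le_trans s21.
  have [s12e|s12'] := eqVneq s1 s2.
    by have -> : t = s1 by apply/eqP; rewrite eq_le t1 s12e t2.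
  have ds : 0 < s2 - s1 by rewrite subr_gt0 lt_neqAle s12' s12.
  have -> : ray x t = ray x s1 + ((t - s1) / (s2 - s1)) *: (ray x s2 - ray x s1).
    rewrite /ray; apply/rowP => i; rewrite !mxE; field; exact: lt0r_neq0.
  apply: convex_set_segment => //.
  - by rewrite divr_ge0 ?subr_ge0// ltW.
  - by rewrite ler_pdivrMr// mul1r lerD2r.
have [h|h] := connected_subset (separated_open_disjoint oD oD' DD') sub conn.
- have : (D `&` D') (ray x s2); last by rewrite DD'.
  by split=> //; apply: h; exists s2 => //; rewrite /= in_itv /= s12 lexx.
- have : (D `&` D') (ray x s1); last by rewrite DD'.
  by split=> //; apply: h; exists s1 => //; rewrite /= in_itv /= s12 lexx.
Qed.

(** Let [tau] be the supremum of the times spent in [Omega]. A point of [M] on the ray lies in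
    [Omega], so none occurs after [tau]; one at [tau] itself would, [Omega] being open, let the ray
    stay in [Omega] past [tau], unless [tau = 1], where the ray is at [x]. As [M] is closed, a time
    in [Omega] just before [tau] works. *)
Let cover_phase x : Omega' x -> ~ M x -> exists s : R,
  [/\ 0 <= s, s <= 1, (Omega `\` M) (ray x s) &
    forall t, s <= t -> t <= 1 -> ~ M (ray x t)].
Proof.
move=> Ox Mx.
have Or t : 0 <= t -> t <= 1 -> Omega' (ray x t).
  by move=> t0 t1; apply: convex_set_segment => //; exact: MOmega'.
pose T := [set t : R | [/\ 0 <= t, t <= 1 & Omega (ray x t)]].
have T0 : T 0 by split => //; rewrite /ray scale0r addr0; exact: MOmega.
have Tub : ubound T 1 by move=> t [].
have supT : has_sup T by split; [exists 0|exists 1].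
pose tau := sup T.
have tau0 : 0 <= tau by apply: ub_le_sup => //; exists 1.
have tau1 : tau <= 1 by apply: ge_sup => //; exists 0.
have Mtau : ~ M (ray x tau).
  move=> Mt; have Ot := MI Mt (Or _ tau0 tau1).
  have [t1|t1] := eqVneq tau 1; first by rewrite t1 ray1 in Mt.
  have {}t1 : tau < 1 by rewrite lt_neqAle t1.
  have /nbhs_ballP[e /= e0 he] : nbhs tau (ray x @^-1` Omega).
    by apply: ray_contl; exact: open_nbhs_nbhs.
  pose t := Num.min (tau + e / 2) 1.
  have tt : tau < t by rewrite lt_min t1 andbT ltrDl divr_gt0.
  have : T t.
    split; first by rewrite (le_trans tau0)// ltW.
      by rewrite ge_min lexx orbT.
    apply: he; rewrite -ball_normE /= distrC ger0_norm ?subr_ge0 1?ltW//.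
    rewrite ltrBlDl (@le_lt_trans _ _ (tau + e / 2))// ?ge_min ?lexx//.
    by rewrite ltrD2l ltr_pdivrMr// ltr_pMr// ltr1n.
  by move=> /(ub_le_sup (ex_intro _ 1 Tub)); rewrite leNgt tt.
have /nbhs_ballP[e /= e0 he] : nbhs tau (ray x @^-1` (~` M)).
  by apply: ray_contl; apply: open_nbhs_nbhs; split => //; exact: closed_openC.
have [s Ts se] := sup_adherent e0 supT.
have st : s <= tau by apply: ub_le_sup => //; exists 1.
have Ms t : s <= t -> t <= 1 -> ~ M (ray x t).
  move=> st1 t1; have [tt|tt] := leP t tau.
    apply: he; rewrite -ball_normE /= ger0_norm ?subr_ge0//.
    by rewrite ltrBlDr -ltrBlDl (lt_le_trans se).
  move=> Mt; have t0 : 0 <= t by rewrite (le_trans tau0)// ltW.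
  have : T t by split => //; apply: (MI Mt); exact: Or.
  by move=> /(ub_le_sup (ex_intro _ 1 Tub)); rewrite leNgt tt.
have [s0 s1 Os] := Ts.
by exists s; split=> //; split=> //; exact: Ms.
Qed.

Lemma transfer_phases : exists D1' D2', two_phases Omega' M D1' D2'.
Proof.
have [[oD1 oD2] _ D12 DU Mcl] := phases.
(* The new phases extend the old ones: where [x] is already in [D], the time [s = 1] serves. *)
have sub D : D `<=` Omega `\` M -> D `&` Omega' `<=` phase D.
  move=> DO x [Dx Ox]; split=> //; exists 1; split; rewrite ?ray1// => t t1 t1'.
  have -> : t = 1 by apply/eqP; rewrite eq_le t1 t1'.
  by rewrite ray1; have [] := DO _ Dx.
have D1O : D1 `<=` Omega `\` M by rewrite -DU; exact: subsetUl.
have D2O : D2 `<=` Omega `\` M by rewrite -DU; exact: subsetUr.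
have clo D : D `<=` Omega `\` M -> M `&` Omega `<=` closure D ->
    M `&` Omega' `<=` closure (phase D).
  move=> DO Mc x [Mx Ox] B Bx; have cDx := Mc x (conj Mx (MI Mx Ox)).
  have [y [Dy [By Oy]]] := cDx _ (filterI Bx (open_nbhs_nbhs (conj oOmega' Ox))).
  by exists y; split=> //; exact: sub.
have clo1 : M `&` Omega' `<=` closure (phase D1) by apply: clo => // x /Mcl[].
have clo2 : M `&` Omega' `<=` closure (phase D2) by apply: clo => // x /Mcl[].
(* An old phase might not obviously meet [Omega']; it does near [x0], which is in its closure. *)
have ne D : M `&` Omega' `<=` closure (phase D) -> phase D !=set0.
  move=> /(_ x0 (conj Mx0.1 (MOmega' Mx0))) /(_ setT filterT) [y [? _]].
  by exists y.
exists (phase D1), (phase D2); split.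
- by split; exact: open_phase.
- by split; exact: ne.
- apply/seteqP; split=> // x [[_ [s1 [s10 s11 Ds1 Ms1]]] [_ [s2 [s20 s21 Ds2 Ms2]]]].
  have [s12|/ltW s12] := leP s1 s2.
    exact: (segment_monochrome oD1 oD2 D12 DU s10 s12 s21 Ds1 Ds2 Ms1).
  rewrite setUC in DU; rewrite setIC in D12.
  exact: (segment_monochrome oD2 oD1 D12 DU s20 s12 s11 Ds2 Ds1 Ms2).
- apply/seteqP; split=> x.
    case=> -[Ox [s [s0 s1 Ds Ms]]]; split=> //; have := Ms 1 s1 (lexx _); rewrite ray1//.
  move=> [Ox Mx]; have [s [s0 s1 + Ms]] := cover_phase Ox Mx.
  by rewrite -DU => -[Ds|Ds]; [left|right]; split=> //; exists s.
- by move=> x Mx; split; [exact: clo1|exact: clo2].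
Qed.

End TransferPhases.

(** * Hausdorff measure as a metric outer measure *)

Section MetricOuterMeasure.
Context {R : realType} {N : nat}.
Local Notation E := 'rV[R]_N.
Implicit Types (A B X F : set E) (d : nat) (delta e : R).
Local Open Scope ereal_scope.

Lemma le_diam A B : A `<=` B -> diam A <= diam B.
Proof.
move=> AB; apply: ge_ereal_sup => _ [z [Az1 Az2] <-].
by apply: ereal_sup_ubound; exists z => //; split; exact: AB.
Qed.

Lemma diam_ge (A : set E) x y : A x -> A y -> (enorm (x - y))%:E <= diam A.
Proof. by move=> Ax Ay; apply: ereal_sup_ubound; exists (x, y). Qed.

Lemma diam_ge0 A : A !=set0 -> 0 <= diam A.
Proof.
by move=> [x Ax]; apply: le_trans (diam_ge Ax Ax); rewrite lee_fin sqrtr_ge0.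
Qed.

Lemma diam_fin_num A delta : A !=set0 -> diam A <= delta%:E -> diam A \is a fin_num.
Proof.
move=> A0 Ad; rewrite ge0_fin_numE ?diam_ge0//.
by apply: (le_lt_trans Ad); rewrite ltry.
Qed.

Lemma le_hgauge d delta A B : A `<=` B -> hgauge d delta A <= hgauge d delta B.
Proof.
move=> AB; have [->|/set0P A0] := eqVneq A set0; first by rewrite hgauge0 hgauge_ge0.
have B0 : B !=set0 by case: A0 => x /AB; exists x.
have /negbTE A0' : A != set0 by apply/set0P.
have /negbTE B0' : B != set0 by apply/set0P.
rewrite /hgauge A0' B0'.
have [dB|dB] := leP (diam B) delta%:E; last by rewrite leey.
have dA : diam A <= delta%:E by apply: le_trans dB; exact: le_diam.
rewrite dA lee_fin ler_wpM2l ?ball_volume_ge0//.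
have fA := diam_fin_num A0 dA; have fB := diam_fin_num B0 dB.
have leAB : (fine (diam A) <= fine (diam B))%R by apply: fine_le => //; exact: le_diam.
have fA0 : (0 <= fine (diam A))%R by apply: fine_ge0; exact: diam_ge0.
rewrite lerXn2r ?nnegrE ?divr_ge0//; first exact: le_trans leAB.
by rewrite ler_wpM2r.
Qed.

Lemma le_hgauge_delta d delta1 delta2 A : (delta1 <= delta2)%R ->
  hgauge d delta2 A <= hgauge d delta1 A.
Proof.
move=> d12; rewrite /hgauge; case: ifP => // _.
have [h1|h1] := leP (diam A) delta1%:E; last by rewrite leey.
by rewrite (le_trans h1).
Qed.

Lemma le_hcontent_delta d delta1 delta2 A : (delta1 <= delta2)%R ->
  hcontent d delta2 A <= hcontent d delta1 A.
Proof.
move=> d12; apply: le_ereal_inf_tmp => _ [F AF <-].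
apply: (@le_trans _ _ (\sum_(k <oo) hgauge d delta2 (F k))).
  by apply: ereal_inf_lbound; exists F.
apply: lee_nneseries => [k _ _|k _]; first exact: hgauge_ge0.
exact: le_hgauge_delta.
Qed.

Lemma hcontent_le d delta A (F : (set E)^nat) : A `<=` \bigcup_k F k ->
  hcontent d delta A <= \sum_(k <oo) hgauge d delta (F k).
Proof. by move=> AF; apply: ereal_inf_lbound; exists F. Qed.

Lemma hcontent_le_hausdorff d delta A : (0 < delta)%R ->
  hcontent d delta A <= hausdorff d A.
Proof. by move=> d0; apply: ereal_sup_ubound; exists delta. Qed.

(** A covering set that meets both [A] and [B] has diameter at least [e > delta], so its gauge is
    infinite; every other one meets at most one of them, and the cover splits. *)
Lemma hcontentU_far d delta e A B : (delta < e)%R ->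
  (forall a b, A a -> B b -> (e <= `|a - b|)%R) ->
  hcontent d delta A + hcontent d delta B <= hcontent d delta (A `|` B).
Proof.
move=> de AB; apply: le_ereal_inf_tmp => _ [F ABF <-].
apply: (@le_trans _ _ (\sum_(k <oo) (hgauge d delta (F k `&` A) + hgauge d delta (F k `&` B)))).
  rewrite nneseriesD; [|by move=> *; exact: hgauge_ge0..].
  apply: leeD; apply: hcontent_le => x h.
  - by have [|k _ Fk] := ABF x; [left|exists k].
  - by have [|k _ Fk] := ABF x; [right|exists k].
apply: lee_nneseries => [k _ _|k _]; first by rewrite adde_ge0 ?hgauge_ge0.
have [->|/set0P[a [Fa Aa]]] := eqVneq (F k `&` A) set0.
  by rewrite hgauge0 add0e; apply: le_hgauge => x [].
have [->|/set0P[b [Fb Bb]]] := eqVneq (F k `&` B) set0.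
  by rewrite hgauge0 adde0; apply: le_hgauge => x [].
rewrite [leRHS]/hgauge; have /negbTE -> : F k != set0 by apply/set0P; exists a.
rewrite ifF ?leey//; apply/negbTE; rewrite -ltNge.
apply: (@lt_le_trans _ _ e%:E); first by rewrite lte_fin.
apply: le_trans (diam_ge Fa Fb); rewrite lee_fin.
by apply: le_trans (norm_le_enorm _); exact: AB.
Qed.

(** The two suprema are approached at separate scales [d1] and [d2]; passing to a common smaller
    scale below [e] only increases the contents. *)
Lemma hausdorffU_far d e A B : (0 < e)%R ->
  (forall a b, A a -> B b -> (e <= `|a - b|)%R) ->
  hausdorff d A + hausdorff d B <= hausdorff d (A `|` B).
Proof.
move=> e0 AB.
have [->|Xoo] := eqVneq (hausdorff d (A `|` B)) +oo; first by rewrite leey.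
have fin C : C `<=` A `|` B -> hausdorff d C \is a fin_num.
  move=> CU; rewrite ge0_fin_numE ?hausdorff_ge0//.
  by apply: (le_lt_trans (le_hausdorff d CU)); rewrite ltey.
have fB : hausdorff d B \is a fin_num by apply: fin; exact: subsetUr.
rewrite -leeBrDr//; apply: ge_ereal_sup => _ [d1 /= d10 <-].
have f1 : hcontent d d1 A \is a fin_num.
  rewrite ge0_fin_numE ?hcontent_ge0//.
  apply: (le_lt_trans (hcontent_le_hausdorff d A d10)).
  by rewrite -ge0_fin_numE ?hausdorff_ge0//; apply: fin; exact: subsetUl.
rewrite leeBrDr// addeC -leeBrDr//; apply: ge_ereal_sup => _ [d2 /= d20 <-].
rewrite leeBrDr//.
pose delta : R := (Num.min (Num.min d1 d2) (e / 2))%R.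
have delta0 : (0 < delta)%R by rewrite !lt_min d10 d20 divr_gt0.
have de : (delta < e)%R.
  rewrite (@le_lt_trans _ _ (e / 2)%R)//; first by rewrite ge_min lexx orbT.
  by rewrite ltr_pdivrMr// ltr_pMr// ltr1n.
apply: le_trans (hcontent_le_hausdorff d (A `|` B) delta0).
apply: le_trans (hcontentU_far d de AB); rewrite addeC; apply: leeD;
  by apply: le_hcontent_delta; rewrite !ge_min lexx ?orbT.
Qed.

(* Caratheodory's criterion. The layers r k of X at distance about 1/k from F
   satisfy mu (r (k+1)) + mu (Y k) <= mu (Y (k+2)), which telescopes. *)
Lemma closed_hausdorff_measurable d F : closed F ->
  (houter d : set E -> \bar R).-cara.-measurable F.
Proof.
move=> clF; apply: le_caratheodory_measurable => X /=.
change (hausdorff d (X `&` F) + hausdorff d (X `&` ~` F) <= hausdorff d X).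
have [->|Xoo] := eqVneq (hausdorff d X) +oo; first by rewrite leey.
have fin C : C `<=` X -> hausdorff d C \is a fin_num.
  move=> CX; rewrite ge0_fin_numE ?hausdorff_ge0//.
  by apply: (le_lt_trans (le_hausdorff d CX)); rewrite ltey.
pose Y (k : nat) : set E := [set x | X x /\ forall y, F y -> (k.+1%:R^-1 <= `|x - y|)%R].
have YX k : Y k `<=` X by move=> x [].
have leY k : Y k `<=` Y k.+1.
  move=> x [Xx h]; split=> // y /h; apply: le_trans.
  by rewrite lef_pV2 ?posrE ?ltr0n// ler_nat.
pose a k : R := fine (hausdorff d (Y k)).
have aE k : hausdorff d (Y k) = (a k)%:E by rewrite fineK// fin.
have YF k : hausdorff d (X `&` F) + hausdorff d (Y k) <= hausdorff d X.
  apply: (@le_trans _ _ (hausdorff d ((X `&` F) `|` Y k))); last first.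
    by apply: le_hausdorff => x [[]//|/YX].
  apply: (@hausdorffU_far d k.+1%:R^-1) => // x y [_ Fx] [_ /(_ x Fx)].
  by rewrite distrC.
pose r k := Y k.+1 `\` Y k.
(* A point outside [Y k.+1] is closer than [1/(k+2)] to [F], whereas [Y k] keeps distance [1/(k+1)]:
   skipping one layer leaves a positive gap. *)
have rY k : hausdorff d (r k.+1) <= (a k.+2 - a k)%:E.
  rewrite EFinB -!aE leeBrDr ?fin//.
  apply: (@le_trans _ _ (hausdorff d (r k.+1 `|` Y k))); last first.
    by apply: le_hausdorff => x [[]//|/leY/leY].
  have gap : (0 < k.+1%:R^-1 - k.+2%:R^-1 :> R)%R.
    by rewrite subr_gt0 ltf_pV2 ?posrE ?ltr0n// ltr_nat.
  apply: (hausdorffU_far d gap) => z x [[Xz _] nYz] [_ Yx].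
  have [y [Fy zy]] : exists y, F y /\ (`|z - y| < k.+2%:R^-1)%R.
    apply: contrapT => h; apply: nYz; split=> // y Fy; rewrite leNgt; apply/negP => zy.
    by apply: h; exists y.
  rewrite lerBlDr; apply: (le_trans (Yx y Fy)); apply: (le_trans (ler_distD z _ _)).
  by rewrite (distrC x z) lerD2l ltW.
have abnd k : (a k <= fine (hausdorff d X))%R.
  by apply: fine_le; rewrite ?fin//; exact: le_hausdorff.
pose l := sup (range a).
have supa : has_sup (range a).
  by split; [exists (a 0%N), 0%N|exists (fine (hausdorff d X)) => _ [k _ <-]].
have al k : (a k <= l)%R by apply: ub_le_sup; [case: supa|exists k].
have XF : X `&` ~` F = \bigcup_k Y k.
  apply/seteqP; split=> [x [Xx nFx]|x [k _ [Xx h]]]; last first.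
    split=> // Fx; have := h x Fx; rewrite subrr normr0 leNgt => /negP; apply.
    by rewrite invr_gt0.
  have /nbhs_ballP[e /= e0 he] : nbhs x (~` F).
    by apply: open_nbhs_nbhs; split => //; exact: closed_openC.
  have [k ke] : exists k, (k.+1%:R^-1 < e)%R.
    exists (Num.truncn e^-1); rewrite invf_plt ?posrE//.
    exact: truncnS_gt.
  exists k => //; split=> // y Fy; rewrite leNgt; apply/negP => xy.
  by apply: (he y) => //; rewrite -ball_normE /=; exact: lt_trans ke.
(* Because the layer bounds skip an index, the telescoped sum keeps two top terms, each at most [l].
   Letting [a k] approach [l] then gives the bound [l]. *)
have bnd k : hausdorff d (X `&` ~` F) <= (2 * l - a k)%:E.
  pose B (j : nat) := if j is i.+1 then r (k + i).+1 else Y k.+1.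
  have XB : X `&` ~` F `<=` \bigcup_j B j.
    rewrite XF => x [j _ Yj]; elim: j Yj => [|j IH] Yj.
      exists 0%N => //=; elim: (k) => [|i]; [exact: leY|exact: leY].
    have [Yj'|nYj] := pselect (Y j x); first exact: IH.
    have [jk|kj] := leqP j k.
      exists 0%N => //=; rewrite -(subnK jk) -addnS; elim: (k - j)%N => //= i; exact: leY.
    exists (j - k)%N => //; case: j Yj nYj kj {IH} => // j Yj nYj kj.
    by rewrite subSn//= subnKC.
  apply: (le_trans (le_hausdorff d XB)).
  apply: (le_trans (hausdorff_sigma_subadditive d B)).
  have part m : \sum_(0 <= j < m.+1) hausdorff d (B j) <= (a (k + m).+1 + a (k + m)%N - a k)%:E.
    elim: m => [|m IH]; first by rewrite big_nat1 /= addn0 aE lee_fin addrK.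
    rewrite big_nat_recr//=; apply: (le_trans (leeD IH (rY _))).
    by rewrite -EFinD lee_fin !addnS; lra.
  apply: lime_le; first by apply: is_cvg_nneseries => j _ _; exact: hausdorff_ge0.
  near=> m; have m0 : (0 < m)%N by near: m; exact: nbhs_infty_gt.
  rewrite -(prednK m0); apply: (le_trans (part _)); rewrite lee_fin.
  have := al (k + m.-1).+1; have := al (k + m.-1)%N; lra.
have bndl : hausdorff d (X `&` ~` F) <= l%:E.
  rewrite -(fineK (fin _ _)); last by move=> x [].
  rewrite lee_fin leNgt; apply/negP => lt.
  have [_ [k _ <-] lk] := sup_adherent (etrans (subr_gt0 _ _) lt) supa.
  have := bnd k; rewrite -[X in X <= _](fineK (fin _ _)); last by move=> x [].
  rewrite lee_fin -/l in lk *; rewrite -/l in lk; lra.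
have fXF : hausdorff d (X `&` F) \is a fin_num by apply: fin => x [].
apply: (@le_trans _ _ (hausdorff d (X `&` F) + l%:E)); first exact: leeD2l.
rewrite addeC -leeBrDr// -(fineK fXF) -(fineK (fin X _))// -EFinB lee_fin.
apply: ge_sup; first by case: supa.
move=> _ [k _ <-]; rewrite -lee_fin EFinB !fineK ?fin// leeBrDr// addeC.
exact: YF.
Unshelve. all: by end_near. Qed.

End MetricOuterMeasure.

(** * Finiteness of the area *)

Section CoordinateEmbedding.
Context {R : realType} {d N : nat}.
Variable iota : 'I_d -> 'I_N.

(** Padding by zeros outside the range of [iota]. In a chart it parametrises [M] when [iota] omits
    the last coordinate, and [bM] when it omits the first and the last. *)
Definition embed (z : 'rV[R]_d) : 'rV[R]_N :=
  \row_j (if [pick i | iota i == j] is Some i then z 0 i else 0).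

Lemma embedB z z' : embed z - embed z' = embed (z - z').
Proof.
by apply/rowP => j; rewrite !mxE; case: pickP => [i _|_]; rewrite ?mxE ?subr0.
Qed.

Lemma norm_embed_le z : `|embed z| <= `|z|.
Proof.
apply: norm_le_coord => // j; rewrite mxE.
by case: pickP => [i _|_]; rewrite ?normr0// coord_le_norm.
Qed.

Lemma embedE z i : injective iota -> embed z 0 (iota i) = z 0 i.
Proof.
move=> inj; rewrite mxE; case: pickP => [i' /eqP/inj -> //|/(_ i)].
by rewrite eqxx.
Qed.

Lemma embed_out z j : (forall i, iota i != j) -> embed z 0 j = 0.
Proof. by move=> h; rewrite mxE; case: pickP => // i; rewrite (negbTE (h i)). Qed.

Lemma norm_embed z : injective iota -> `|embed z| = `|z|.
Proof.
move=> inj; apply/eqP; rewrite eq_le norm_embed_le /=.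
by apply: norm_le_coord => // i; rewrite -(embedE _ _ inj) coord_le_norm.
Qed.

End CoordinateEmbedding.

Section FiniteArea.
Context {R : realType} {N : nat}.
Local Notation E := 'rV[R]_N.

Lemma hcontent_le_finite (d : nat) (delta : R) (I : finType) (A : set E) (F : I -> set E) :
  A `<=` \bigcup_i F i ->
  (hcontent d delta A <= \sum_i hgauge d delta (F i))%E.
Proof.
move=> AF; pose S := [seq F i | i <- index_enum I].
apply: (@le_trans _ _ (\sum_(k <oo) hgauge d delta (nth set0 S k))%E).
  apply: hcontent_le => x /AF[i _ Fi]; exists (index i (index_enum I)) => //=.
  by rewrite (nth_map i) ?nth_index ?index_mem ?mem_index_enum.
rewrite (@nneseries_split _ _ 0 (size S)); last by move=> k _; exact: hgauge_ge0.
rewrite add0n [X in (_ + X)%E]eseries0 ?adde0; last first.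
  by move=> k Sk _; rewrite nth_default ?hgauge0.
by rewrite -(big_nth set0 predT (hgauge d delta)) big_map.
Qed.

(** A sup-norm ball is a cube. Cut into [m ^ d] cells, it yields images of diameter at most [D / m],
    whose gauges add up to a number free of [m]; so the bound is uniform in [delta]. *)
Lemma hausdorff_lipschitz_image_lty (d : nat) (A : set E) (g : 'rV[R]_d -> E) (rho L : R) :
  0 < rho -> 0 <= L ->
  (forall z z', ball 0 rho z -> ball 0 rho z' -> `|g z - g z'| <= L * `|z - z'|) ->
  A `<=` g @` ball 0 rho -> (hausdorff d A < +oo)%E.
Proof.
move=> rho0 L0 lip Ag.
(* The side of the cube is [2 * rho], and [N] is the cost of passing from the sup norm to the
   Euclidean norm. *)
pose D := N%:R * (L * (2 * rho)).
have D0 : 0 <= D by rewrite !mulr_ge0// ltW.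
apply: (@le_lt_trans _ _ (ball_volume d * (D / 2) ^+ d)%:E); last by rewrite ltry.
apply: ge_ereal_sup => _ [delta /= delta0 <-].
pose m := (Num.truncn (D / delta)).+1.
have m0 : 0 < m%:R :> R by rewrite ltr0n.
have Dm : D / m%:R <= delta.
  by rewrite ler_pdivrMr// mulrC -ler_pdivrMr// ltW// truncnS_gt.
(* Rescales the interval from [-rho] to [rho] to length [m], so that truncation gives the index of
   the cell. *)
pose u (z : 'rV[R]_d) i := (z 0 i + rho) * m%:R / (2 * rho).
pose C (c : {ffun 'I_d -> 'I_m}) := [set z : 'rV[R]_d | ball 0 rho z /\
  forall i, Num.truncn (u z i) = c i].
have zi (z : 'rV[R]_d) i : ball 0 rho z -> - rho < z 0 i < rho.
  rewrite -ball_normE /= sub0r normrN => h.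
  by rewrite -ltr_norml (le_lt_trans (coord_le_norm _ _)).
have u0 z i : ball 0 rho z -> 0 <= u z i.
  move=> /(zi _ i)/andP[h1 h2]; rewrite /u divr_ge0 ?mulr_ge0 ?ltW//; lra.
have um z i : ball 0 rho z -> u z i < m%:R.
  move=> /(zi _ i)/andP[h1 h2]; rewrite /u ltr_pdivrMr ?mulr_gt0// mulrC ltr_pM2l//.
  lra.
have cov : A `<=` \bigcup_c (g @` C c).
  move=> x /Ag[z zr <-].
  have tm i : (Num.truncn (u z i) < m)%N.
    by rewrite -(ltr_nat R) (le_lt_trans _ (um z i zr))// truncn_le// u0.
  exists [ffun i => Ordinal (tm i)] => //; exists z => //; split=> // i.
  by rewrite ffunE.
apply: (le_trans (hcontent_le_finite d delta cov)).
apply: (@le_trans _ _ (\sum_(c : {ffun 'I_d -> 'I_m}) (ball_volume d * (D / m%:R / 2) ^+ d)%:E)%E).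
  apply: lee_sum => c _; rewrite /hgauge; case: ifPn => [_|/set0P ne].
    by rewrite lee_fin mulr_ge0 ?ball_volume_ge0// exprn_ge0// !divr_ge0// ltW.
  have dm : (diam (g @` C c) <= (D / m%:R)%:E)%E.
    apply: ge_ereal_sup => _ [[x x'] [/= [z [zr zc] <-] [z' [zr' zc'] <-]] <-].
    rewrite lee_fin /=; apply: (le_trans (enorm_le_norm _)).
    rewrite /D -!mulrA ler_wpM2l//; apply: (le_trans (lip _ _ zr zr')).
    rewrite ler_wpM2l//; apply: norm_le_coord.
      by rewrite mulrA divr_ge0 ?mulr_ge0 ?ltW.
    move=> i; rewrite !mxE.
    have tE : Num.truncn (u z i) = Num.truncn (u z' i) by rewrite zc zc'.
    have /andP[h1 h2] := truncn_itv (u0 z i zr).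
    have /andP[h3 h4] := truncn_itv (u0 z' i zr').
    rewrite tE in h1 h2.
    have -> : z 0 i - z' 0 i = (u z i - u z' i) * (2 * (rho / m%:R)).
      by rewrite /u; field; rewrite !gt_eqF.
    have c0 : 0 <= 2 * (rho / m%:R) by rewrite mulr_ge0// divr_ge0// ltW.
    rewrite normrM (ger0_norm c0); apply: ler_piMl => //.
    move: h2 h4; rewrite -natr1 => h2 h4.
    by rewrite ltW// ltr_norml; apply/andP; split; lra.
  rewrite ifT; last by apply: (le_trans dm); rewrite lee_fin.
  have f0 := diam_fin_num ne dm; have d0 := fine_ge0 (diam_ge0 ne).
  have e1 : 0 <= fine (diam (g @` C c)) / 2 by rewrite divr_ge0.
  have e2 : 0 <= D / m%:R / 2 by rewrite !divr_ge0// ltW.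
  rewrite lee_fin ler_wpM2l ?ball_volume_ge0// lerXn2r ?nnegrE//.
  by rewrite ler_wpM2r// -lee_fin fineK.
rewrite sumEFin lee_fin sumr_const card_ffun !card_ord.
rewrite -[_ *+ (m ^ d)%N]mulr_natl natrX mulrCA -exprMn; set X := _ * (_ / _ / _).
by have -> : X = D / 2 by rewrite /X; field; exact: lt0r_neq0.
Qed.

End FiniteArea.

Section AreaOfHypersurface.
Context {R : realType} {n : nat}.
Local Notation E := 'rV[R]_n.+2.

Lemma C2_chart_C1 (U : set E) (phi psi : E -> E) : C2_chart U phi psi ->
  Ck 1 U phi /\ Ck 1 (phi @` U) psi.
Proof.
move=> [_ _ [d1 C1] [d2 C2] _]; split; split=> // v x Ux.
- by apply: differentiable_continuous; apply: (C1 v).1.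
- by apply: differentiable_continuous; apply: (C2 v).1.
Qed.

(** Near [p], [M] lies in the image under the Lipschitz map [psi] of a piece of a hyperplane. Only
    this inclusion is required, so interior and boundary charts are treated alike. *)
Lemma hausdorff_chart_lty (M U : set E) (phi psi : E -> E) (p : E) :
  C2_chart U phi psi -> U p -> phi p 0 ord_max = 0 ->
  (forall x, U x -> M x -> phi x 0 ord_max = 0) ->
  exists W, [/\ open W, W p & (hausdorff n.+1 (M `&` W) < +oo)%E].
Proof.
move=> ch Up p0 M0; have [oU oV _ _ K] := ch.
have [Cphi Cpsi] := C2_chart_C1 ch.
have Vp : (phi @` U) (phi p) by exists p.
have [r [L [r0 L0 rV lip]]] := C1_locally_lipschitz oV Vp Cpsi.
exists (U `&` phi @^-1` ball (phi p) r); split.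
- rewrite openE => x [Ux xr]; apply: filterI; first exact: open_nbhs_nbhs.
  have cx : {for x, continuous phi}.
    by apply: differentiable_continuous; apply: Cphi.1.
  by apply: cx; apply: open_nbhs_nbhs; split => //; exact: ball_open.
- by split=> //=; exact: ballxx.
pose iota : 'I_n.+1 -> 'I_n.+2 := lift ord_max.
have inj : injective iota by exact: lift_inj.
have ballE z : ball 0 r z -> ball (phi p) r (phi p + embed iota z).
  rewrite -!ball_normE /= sub0r normrN opprD addNKr normrN.
  exact/le_lt_trans/norm_embed_le.
apply: (@hausdorff_lipschitz_image_lty _ _ _ _
  (fun z : 'rV[R]_n.+1 => psi (phi p + embed iota z)) r L) => //; first exact: ltW.
- move=> z z' zr zr'; apply: (le_trans (lip _ _ (ballE _ zr) (ballE _ zr'))).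
  rewrite (ler_wpM2l (ltW L0))// opprD addrACA subrr add0r embedB.
  exact: norm_embed_le.
- move=> x [Mx [Ux /= xr]].
  pose z : 'rV[R]_n.+1 := \row_i (phi x 0 (iota i) - phi p 0 (iota i)).
  have zE : phi p + embed iota z = phi x.
    apply/rowP => j; rewrite mxE; case: (unliftP ord_max j) => [i ->|->].
      by rewrite embedE// mxE subrKC.
    rewrite p0 (M0 x)// embed_out ?addr0// => i.
    by rewrite eq_sym neq_lift.
  exists z; last by rewrite zE K.
  move: xr; rewrite -!ball_normE /= sub0r normrN -zE opprD addNKr normrN.
  by rewrite norm_embed.
Qed.

Lemma hausdorff_hypersurface_lty (M bM : set E) :
  C2_hypersurface_with_boundary M bM -> (hausdorff n.+1 M < +oo)%E.
Proof.
move=> [cM bMM chi chb].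
have loc p : M p -> exists W, [/\ open W, W p & (hausdorff n.+1 (M `&` W) < +oo)%E].
  move=> Mp; have [bMp|nbMp] := pselect (bM p).
    have [U [phi [psi [ch Up UM]]]] := chb p bMp.
    apply: (hausdorff_chart_lty ch Up); first by have := UM p Up; tauto.
    by move=> x /UM; tauto.
  have [U [phi [psi [ch Up UM]]]] := chi p (conj Mp nbMp).
  apply: (hausdorff_chart_lty ch Up); first by have := UM p Up; tauto.
  by move=> x /UM; tauto.
have /compact_near_coveringP cov := cM.
pose good (A : set E) := (hausdorff n.+1 (M `&` A) < +oo)%E.
(* Compactness enters as a near-covering property, with the good sets directed by inclusion as
   parameters: stability under unions makes [F] a filter, and local goodness then yields one good
   set containing [M]. *)
pose F : set_system (set E) := [set P | exists2 A, good A & forall B, good B -> A `<=` B -> P B].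
have goodU A B : good A -> good B -> good (A `|` B).
  rewrite /good setIUr => gA gB.
  apply: (@le_lt_trans _ _ (hausdorff n.+1 (M `&` A) + hausdorff n.+1 (M `&` B))%E).
    exact: (outer_measureU2 (houter n.+1)).
  by rewrite lte_add_pinfty.
have FF : Filter F.
  split.
  - by exists set0 => //; rewrite /good setI0 hausdorff0.
  - move=> P Q [A gA PA] [B gB QB]; exists (A `|` B); first exact: goodU.
    by move=> C gC ABC; split; [apply: PA|apply: QB] => // x ?; apply: ABC; [left|right].
  - by move=> P Q PQ [A gA PA]; exists A => // B gB AB; apply: PQ; exact: PA.
have := cov _ F (fun A x => A x /\ good A) FF.
case.
  move=> x Mx; have [W [oW Wx gW]] := loc x Mx.
  exists (W, [set B | good B /\ W `<=` B]) => /=.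
    split; first exact: open_nbhs_nbhs.
    by exists W => // B gB WB.
  by move=> [y B] [/= Wy [gB WB]]; split=> //; exact: WB.
move=> A gA /(_ A gA (@subset_refl _ A)) MA.
suff <- : M `&` A = M by [].
by apply/seteqP; split=> [x []//|x Mx]; split=> //; have [] := MA x Mx.
Qed.

End AreaOfHypersurface.

(** * Positivity of the measure of the boundary *)

Lemma card_le_spread (m : nat) (P : {set 'I_m}) (t : nat) :
  (forall i j : 'I_m, i \in P -> j \in P -> (i <= j + t)%N) -> (#|P| <= t.+1)%N.
Proof.
move=> Pt; have [->|[i0 Pi0]] := set_0Vmem P; first by rewrite cards0.
case: (arg_minnP (fun i : 'I_m => val i) Pi0) => k Pk kmin.
rewrite -[t.+1]card_ord -(@card_in_imset _ _ (fun i : 'I_m => inord (i - k) : 'I_t.+1)).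
  exact: max_card.
have small i : i \in P -> (i - k < t.+1)%N.
  by move=> Pi; rewrite ltnS leq_subLR; exact: Pt.
move=> i j Pi Pj /(congr1 val) /=; rewrite !inordK ?small// => ij.
by apply: val_inj; rewrite /= -(subnK (kmin i Pi)) ij subnK//; exact: kmin.
Qed.

(** [S] lies in the product of its projections, each of which fits in an interval of integers of
    length [T]. *)
Lemma card_le_spread_ffun (R : realType) (d m : nat) (S : {set {ffun 'I_d -> 'I_m}}) (T : R) :
  0 <= T ->
  (forall c c' i, c \in S -> c' \in S -> `|(c i)%:R - (c' i)%:R| <= T) ->
  #|S|%:R <= (T + 1) ^+ d.
Proof.
move=> T0 ST; pose t := Num.truncn T.
apply: (@le_trans _ _ (t.+1 ^ d)%:R); last first.
  by rewrite natrX lerXn2r ?nnegrE ?addr_ge0// -natr1 lerD2r truncn_le.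
rewrite ler_nat; pose P i : {set 'I_m} := imset (fun c : {ffun 'I_d -> 'I_m} => c i) (mem S).
apply: (@leq_trans #|family (fun i => mem (P i))|).
  apply: subset_leq_card; apply/fintype.subsetP => c Sc; apply/familyP => i.
  exact: imset_f.
rewrite card_family; apply: (@leq_trans (\prod_(i < d) t.+1)); last first.
  by rewrite prod_nat_const card_ord.
rewrite foldrE big_map big_enum /=; apply: leq_prod => i _.
apply: card_le_spread => _ _ /imsetP[c Sc ->] /imsetP[c' Sc' ->].
rewrite leqNgt; apply/negP => lt.
have := ST c c' i Sc Sc'; rewrite leNgt => /negP; apply.
apply: (lt_le_trans (truncnS_gt T)); apply: le_trans (ler_norm _).
by rewrite lerBrDr -natrD ler_nat addSn addnC.
Qed.

(** Covering sets of diameter [a] are thickened by [e] to become open: this costs [2 * e], and the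
    third [e] absorbs the rounding in the count of grid points. *)
Lemma exists_enlargement (R : realType) (d : nat) (a eps : R) : 0 < eps ->
  exists2 e : R, 0 < e & (a + 3 * e) ^+ d <= a ^+ d + eps.
Proof.
move=> eps0.
have c : (a + 3 * e) ^+ d @[e --> (0 : R)] --> (a + 3 * 0) ^+ d.
  apply: (@continuous_comp _ _ _ (fun e : R => a + 3 * e) (fun x => x ^+ d)).
    apply: cvgD; first exact: cvg_cst.
    by apply: cvgM; [exact: cvg_cst|exact: cvg_id].
  exact: exprn_continuous.
rewrite mulr0 addr0 in c.
have /nbhs_ballP[e /= e0 he] : \forall e \near (0 : R), (a + 3 * e) ^+ d <= a ^+ d + eps.
  by apply: (cvgr_le (a ^+ d) c); rewrite ltrDl.
exists (e / 2); first exact: divr_gt0.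
apply: he; rewrite -ball_normE /= sub0r normrN ger0_norm ?divr_ge0 ?ltW//.
by rewrite ltr_pdivrMr// ltr_pMr// ltr1n.
Qed.

Lemma ball_volume_gt0 (R : realType) d : 0 < ball_volume d :> R.
Proof.
suff: (0 < ball_volume d :> R) && (0 < ball_volume d.+1 :> R) by case/andP.
elim: d => [|d /andP[h0 h1]]; first by rewrite /= ltr01 ltr0n.
by rewrite h1 /= mulr_gt0// divr_gt0 ?ltr0n// mulr_gt0 ?ltr0n// pi_gt0.
Qed.

Section PositiveMeasure.
Context {R : realType} {N d : nat}.
Local Notation E := 'rV[R]_N.
Variables (A : set E) (g : 'rV[R]_d -> E) (rho L : R).
Let Q := [set z : 'rV[R]_d | forall i, [set` `[0, rho]] (z 0 i)].
Hypotheses (rho0 : 0 < rho) (L0 : 0 < L).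
Hypothesis cont_g : {within Q, continuous g}.
Hypothesis colip : forall z z', Q z -> Q z' -> `|z - z'| <= L * `|g z - g z'|.
Hypothesis gA : g @` Q `<=` A.

Let cQ : compact (g @` Q).
Proof.
apply: continuous_compact cont_g _.
exact: (@rV_compact R d (fun=> [set` `[0, rho]]) (fun=> @segment_compact R 0 rho)).
Qed.

(* Counting the points of a fine grid of the cube: a set of diameter b contains
   at most about (L b m / rho)^d of the m^d points. *)
Let grid_count K (F : nat -> set E) (a e : nat -> R) :
  (forall k, 0 <= a k) -> (forall k, 0 < e k) ->
  (forall k x y, F k x -> F k y -> `|x - y| <= a k) ->
  g @` Q `<=` (fun x => exists2 k, (k < K)%N & exists2 y, F k y & `|y - x| < e k) ->
  (rho / L) ^+ d <= \sum_(k < K | F k != set0) (a k + 3 * e k) ^+ d.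
Proof.
move=> a0 e0 Fa cov.
(* The sum dominates each of its terms, so the grid step [rho / m] is at most [L * e k] for all [k]
   at once. *)
pose m := (\sum_(k < K) Num.truncn (rho / (L * e k))).+1.
have m0 : 0 < m%:R :> R by rewrite ltr0n.
have me (k : 'I_K) : rho <= L * e k * m%:R.
  rewrite mulrC -ler_pdivrMr ?mulr_gt0// ltW//; apply: (lt_le_trans (truncnS_gt _)).
  by rewrite ler_nat ltnS (bigD1 k)//= leq_addr.
pose pt (c : {ffun 'I_d -> 'I_m}) : 'rV[R]_d := \row_i (rho * (c i)%:R / m%:R).
have Qpt c : Q (pt c).
  move=> i; rewrite /= mxE in_itv /=; apply/andP; split.
    by rewrite divr_ge0 ?mulr_ge0// ltW.
  by rewrite ler_pdivrMr// ler_pM2l// ler_nat ltnW.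
pose S (k : 'I_K) : {set {ffun 'I_d -> 'I_m}} :=
  finset (fun c => `[< exists2 y, F k y & `|y - g (pt c)| < e k >]).
have SP (k : 'I_K) c : reflect (exists2 y, F k y & `|y - g (pt c)| < e k) (c \in S k).
  by rewrite finset.in_set; exact: asboolP.
have Sk (k : 'I_K) : #|S k|%:R <= (L * (a k + 3 * e k) * m%:R / rho) ^+ d.
  have T0 : 0 <= L * (a k + 2 * e k) * m%:R / rho.
    have := ltW (e0 k); have := ltW L0; have := ltW rho0 => ? ? ?.
    by rewrite !(divr_ge0, mulr_ge0, addr_ge0).
  apply: (@le_trans _ _ ((L * (a k + 2 * e k) * m%:R / rho + 1) ^+ d)).
    apply: card_le_spread_ffun => // c c' i /SP[y Fy yc] /SP[y' Fy' yc'].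
    rewrite ler_pdivlMr//.
    have h1 : `|pt c - pt c'| <= L * (a k + 2 * e k).
      apply: (le_trans (colip (Qpt c) (Qpt c'))); rewrite ler_pM2l//.
      apply: (le_trans (ler_distD y _ _)); rewrite (distrC _ y).
      have := ler_distD y' y (g (pt c')); have := Fa k y y' Fy Fy'; lra.
    have := le_trans (coord_le_norm _ i) h1; rewrite !mxE -mulrBl -mulrBr.
    rewrite normrM (ger0_norm (x := m%:R^-1)) ?invr_ge0//.
    by rewrite ler_pdivrMr// normrM (gtr0_norm rho0) mulrC.
  rewrite lerXn2r ?nnegrE ?addr_ge0//.
    apply: le_trans T0 _; rewrite ler_pM2r ?invr_gt0// ler_pM2r// ler_pM2l// lerD2l.
    by rewrite ler_pM2r// ler_nat.
  rewrite -lerBrDl -mulrBl -mulrBl -mulrBr ler_pdivlMr// mul1r.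
  have -> : a k + 3 * e k - (a k + 2 * e k) = e k by ring.
  exact: me.
(* Double counting: each grid point is near at least one nonempty covering set. *)
have total : (m ^ d)%:R <= \sum_(k < K | F k != set0) #|S k|%:R :> R.
  rewrite -natr_sum ler_nat.
  have -> : (m ^ d)%N = (\sum_(c : {ffun 'I_d -> 'I_m}) 1)%N.
    by rewrite sum1_card card_ffun !card_ord.
  apply: (@leq_trans (\sum_(c : {ffun 'I_d -> 'I_m}) \sum_(k < K | F k != set0) (c \in S k))).
    apply: leq_sum => c _.
    have [k kK [y Fy yc]] := cov (g (pt c)) (ex_intro2 _ _ (pt c) (Qpt c) erefl).
    rewrite (bigD1 (Ordinal kK))/=; last by apply/set0P; exists y.
    by have -> : c \in S (Ordinal kK) by apply/SP; exists y.
  rewrite exchange_big/=; apply: leq_sum => k _.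
  by rewrite -sum1_card [leqRHS]big_mkcond; apply: leq_sum => c _; case: (c \in _).
rewrite natrX in total.
have md0 : 0 < (m%:R : R) ^+ d by exact: exprn_gt0.
have LmE : (rho / L) ^+ d = m%:R ^+ d * (rho / (L * m%:R)) ^+ d.
  by rewrite -exprMn; congr (_ ^+ d); field; rewrite !gt_eqF.
rewrite LmE -ler_pdivlMr ?exprn_gt0 ?divr_gt0 ?mulr_gt0//.
apply: (le_trans total); rewrite mulr_suml; apply: ler_sum => k _.
apply: (le_trans (Sk k)); rewrite -exprVn -exprMn; set X := (X in X ^+ d).
set Y := (Y in _ <= Y ^+ d); have -> : X = Y; last by [].
by rewrite /X /Y; field; rewrite !gt_eqF.
Qed.

(** Counting grid points needs a finite cover. Thickening makes the covering sets open, and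
    compactness of the image of the cube leaves finitely many. *)
Lemma hausdorff_colipschitz_image_gt0 : (0 < hausdorff d A)%E.
Proof.
(* Half of the volume given by [grid_count]; the other half is spent on thickening,
   [eta / 2 ^+ k.+1] for the set of index [k]. *)
pose eta := (rho / L) ^+ d / 2.
have eta0 : 0 < eta by rewrite divr_gt0// exprn_gt0// divr_gt0.
pose v : R := ball_volume d / 2 ^+ d.
have v0 : 0 < v by rewrite divr_gt0 ?ball_volume_gt0// exprn_gt0.
apply: (@lt_le_trans _ _ (v * eta)%:E); first by rewrite lte_fin mulr_gt0.
(* A lower bound at a single scale suffices, here [delta = 1]. *)
apply: le_trans (hcontent_le_hausdorff d A (@ltr01 R)).
apply: le_ereal_inf_tmp => _ [F AF <-].
have [[k Fk]|fin] := pselect (exists k, hgauge d 1 (F k) = +oo%E).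
  rewrite (@eseries_pinfty _ _ _ k)// ?leey// => j _.
  by rewrite gt_eqF// (lt_le_trans _ (hgauge_ge0 _ _ _))// ltNy0.
pose a k : R := if F k == set0 then 0 else fine (diam (F k)).
have hgE k : F k != set0 -> hgauge d 1 (F k) = (v * a k ^+ d)%:E /\ diam (F k) \is a fin_num.
  move=> Fk; rewrite /hgauge /a (negbTE Fk); case: ifPn => [dF|dF].
    split; last by apply: diam_fin_num dF; exact/set0P.
    by rewrite /v exprMn exprVn mulrA mulrAC.
  exfalso; apply: fin; exists k; by rewrite /hgauge (negbTE Fk) (negbTE dF).
have a0 k : 0 <= a k.
  by rewrite /a; case: ifPn => // Fk; apply: fine_ge0; apply: diam_ge0; exact/set0P.
have Fa k x y : F k x -> F k y -> `|x - y| <= a k.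
  move=> Fx Fy; have Fk : F k != set0 by apply/set0P; exists x.
  have [_ fd] := hgE k Fk.
  apply: (le_trans (norm_le_enorm _)); rewrite -lee_fin /a (negbTE Fk) fineK//.
  exact: diam_ge.
have ex k : exists e : R, 0 < e /\ (a k + 3 * e) ^+ d <= a k ^+ d + eta / 2 ^+ k.+1.
  have [|e e0 he] := @exists_enlargement R d (a k) (eta / 2 ^+ k.+1).
    by rewrite divr_gt0// exprn_gt0.
  by exists e.
have [e he] := choice ex.
have [K _ cov] : \forall K \near \oo, g @` Q `<=`
    (fun x => exists2 k, (k < K)%N & exists2 y, F k y & `|y - x| < e k).
  have /compact_near_coveringP h := cQ.
  apply: (h _ _ (fun K x => exists2 k, (k < K)%N & exists2 y, F k y & `|y - x| < e k)).
  move=> x /gA/AF[k _ Fx].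
  exists (ball x (e k), [set K | (k < K)%N]) => /=.
    split; first by apply: nbhsx_ballx; case: (he k).
    exact: nbhs_infty_gt.
  move=> [y K] /= [xy kK]; exists k => //; exists x => //.
  by move: xy; rewrite -ball_normE.
have := grid_count a0 (fun k => (he k).1) Fa (cov K (leqnn K)) => main.
have geo : forall j : nat, \sum_(k < j) eta / 2 ^+ k.+1 = eta - eta / 2 ^+ j.
  elim=> [|j IH]; first by rewrite big_ord0 expr0 divr1 subrr.
  rewrite big_ord_recr/= IH exprS; field.
  by rewrite expf_neq0.
have bnd : eta <= \sum_(k < K | F k != set0) a k ^+ d.
  have h1 : \sum_(k < K | F k != set0) (a k + 3 * e k) ^+ d <=
      \sum_(k < K | F k != set0) a k ^+ d + eta.
    apply: (@le_trans _ _ (\sum_(k < K | F k != set0) (a k ^+ d + eta / 2 ^+ k.+1))).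
      by apply: ler_sum => k _; exact: (he k).2.
    rewrite big_split/= lerD2l.
    apply: (@le_trans _ _ (\sum_(k < K) eta / 2 ^+ k.+1)).
      rewrite [leRHS](bigID (fun k : 'I_K => F k != set0))/= lerDl.
      by apply: sumr_ge0 => k _; rewrite divr_ge0 ?ltW// exprn_gt0.
    by rewrite geo gerBl divr_ge0 ?ltW// exprn_gt0.
  have : (rho / L) ^+ d = 2 * eta by rewrite /eta; field.
  move=> h2; have := le_trans main h1; rewrite h2; lra.
apply: (@le_trans _ _ (\sum_(0 <= k < K) hgauge d 1 (F k))%E); last first.
  by apply: nneseries_lim_ge => *; exact: hgauge_ge0.
rewrite big_mkord (bigID (fun k : 'I_K => F k != set0))/=.
rewrite [X in (_ <= _ + X)%E]big1; last by move=> k /negPn/eqP ->; rewrite hgauge0.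
rewrite adde0 (eq_bigr (fun k : 'I_K => (v * a k ^+ d)%:E)); last by move=> k /hgE[].
by rewrite sumEFin lee_fin -mulr_sumr ler_pM2l.
Qed.

End PositiveMeasure.

Section BoundaryOfHypersurface.
Context {R : realType} {n : nat}.
Local Notation E := 'rV[R]_n.+2.
Variables (M bM : set E).
Hypothesis MbM : C2_hypersurface_with_boundary M bM.

Lemma hypersurface_closed : closed M.
Proof. by have [cM _ _ _] := MbM; apply: compact_closed => //; exact: norm_hausdorff. Qed.

(** A limit of boundary points lies in [M]; an interior chart around it would exclude boundary
    points nearby. *)
Lemma hypersurface_boundary_closed : closed bM.
Proof.
have [_ bMM chi _] := MbM => x cx.
have Mx : M x by apply: hypersurface_closed => B /cx[y [/bMM My By]]; exists y.
apply: contrapT => nbx.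
have [U [phi [psi [[oU _ _ _ _] Ux h]]]] := chi x (conj Mx nbx).
have [y [by_ Uy]] := cx U (open_nbhs_nbhs (conj oU Ux)).
by have [_] := h y Uy.
Qed.

(** Provides the centre of the rays: in a boundary chart, increasing the first coordinate leaves the
    boundary and stays in [M], the first and last coordinates being distinct in dimension at least
    2. *)
Lemma hypersurface_interior_nonempty : bM !=set0 -> (M `\` bM) !=set0.
Proof.
have [_ _ _ chb] := MbM => -[p bp].
have [U [phi [psi [[oU oV _ _ K] Up h]]]] := chb p bp.
have [_ /iffLR/(_ bp)[p1 p0]] := h p Up.
have /nbhs_ballP[r /= r0 rV] : nbhs (phi p) (phi @` U).
  by apply: open_nbhs_nbhs; split=> //; exists p.
have [|x Ux xE] := rV (phi p + (r / 2) *: delta_mx 0 ord0).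
  rewrite -ball_normE /= opprD addNKr normrN; apply: (@le_lt_trans _ _ (r / 2)).
    apply: norm_le_coord => [|i]; first by rewrite divr_ge0// ltW.
    rewrite !mxE normrM ger0_norm ?divr_ge0//; last exact: ltW.
    by apply: ler_piMr; [rewrite divr_ge0// ltW|case: (_ && _); rewrite ?normr1 ?normr0].
  by rewrite ltr_pdivrMr// ltr_pMr// ltr1n.
have x0 : phi x 0 ord0 = r / 2 by rewrite xE !mxE p0 eqxx mulr1 add0r.
have x1 : phi x 0 ord_max = 0 by rewrite xE !mxE p1 /= mulr0 addr0.
have [hM hb] := h x Ux; exists x; split.
  by apply/hM; split=> //; rewrite x0 divr_ge0// ltW.
by move=> /hb[_]; rewrite x0 => /eqP; rewrite gt_eqF// divr_gt0.
Qed.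

(** The Lipschitz bound for [phi] near [p] is the co-Lipschitz bound for [psi], since [phi] inverts
    [psi] there. For [n = 0] the cube is a single point and the measure counts points. *)
Lemma hausdorff_boundary_gt0 (p : E) (W : set E) : bM p -> open W -> W p ->
  (0 < hausdorff n (bM `&` W))%E.
Proof.
have [_ _ _ chb] := MbM => bp oW Wp.
have [U [phi [psi [ch Up h]]]] := chb p bp.
have [oU oV _ _ K] := ch; have [Cphi Cpsi] := C2_chart_C1 ch.
have [_ /iffLR/(_ bp)[p1 p0]] := h p Up.
have [r [L [r0 L0 rU lip]]] := C1_locally_lipschitz oU Up Cphi.
have psi_cont y : (phi @` U) y -> {for y, continuous psi}.
  by move=> Vy; apply: differentiable_continuous; exact: Cpsi.1.
have Vp : (phi @` U) (phi p) by exists p.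
have /nbhs_ballP[s /= s0 hs] : nbhs (phi p) ((phi @` U) `&` psi @^-1` (W `&` ball p r)).
  apply: filterI; first exact: open_nbhs_nbhs.
  apply: psi_cont => //; rewrite K//; apply: filterI; first exact: open_nbhs_nbhs.
  exact: nbhsx_ballx.
pose iota : 'I_n -> 'I_n.+2 := fun i => lift ord_max (lift ord0 i).
have inj : injective iota by move=> i j /lift_inj/lift_inj.
have iota_max i : iota i != ord_max by rewrite eq_sym neq_lift.
have iota_0 i : iota i != ord0.
  by rewrite -val_eqE /= /bump; case: (_ <= _)%N.
pose y (z : 'rV[R]_n) := phi p + embed iota z.
have ys (z : 'rV[R]_n) : `|z| < s -> ball (phi p) s (y z).
  rewrite -ball_normE /= opprD addNKr normrN; exact/le_lt_trans/norm_embed_le.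
have Qs (z : 'rV[R]_n) : (forall i, [set` `[0, s / 2]] (z 0 i)) -> `|z| < s.
  move=> zQ; apply: (@le_lt_trans _ _ (s / 2)).
    apply: norm_le_coord => [|i]; first by rewrite divr_ge0// ltW.
    by have := zQ i; rewrite /= in_itv /= => /andP[z0 zs]; rewrite ger0_norm.
  by rewrite ltr_pdivrMr// ltr_pMr// ltr1n.
have yP z : `|z| < s ->
    [/\ U (psi (y z)), phi (psi (y z)) = y z, W (psi (y z)) & ball p r (psi (y z))].
  move=> /ys/hs[[x Ux xE] [Wx rx]]; move: Wx rx; rewrite -xE K//.
apply: (@hausdorff_colipschitz_image_gt0 _ _ _ _ (psi \o y) (s / 2) L) => //.
- exact: divr_gt0.
- apply: continuous_in_subspaceT => z; rewrite inE => /Qs zs A /= nA.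
  have /hs[Vz _] := ys z zs.
  have /nbhs_ballP[e /= e0 he] := psi_cont _ Vz _ nA.
  apply/nbhs_ballP; exists e => // z'; rewrite -ball_normE /= => zz'.
  apply: he; rewrite -ball_normE /= /y opprD addrACA subrr add0r embedB.
  by apply: le_lt_trans zz'; exact: norm_embed_le.
- move=> z z' /Qs/yP[U1 E1 W1 r1] /Qs/yP[U2 E2 W2 r2].
  have := lip _ _ r1 r2; rewrite /= E1 E2 /y opprD addrACA subrr add0r embedB.
  by rewrite norm_embed.
- move=> _ [z /Qs/yP[U1 E1 W1 r1] <-]; split=> //=.
  apply/(h _ U1).2; rewrite E1 /y; split.
    by rewrite mxE p1 embed_out ?addr0.
  by rewrite mxE p0 embed_out ?addr0.
Qed.

End BoundaryOfHypersurface.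

(** * The test function and its integrals *)

Section IntegralBounds.
Context (disp : measure_display) (T : measurableType disp) (R : realType).
Variable mu : {measure set T -> \bar R}.
Local Open Scope ereal_scope.

(** The integral of a nonnegative function is a supremum over simple functions below it, which is
    monotone without measurability. The curvature integrands require this generality. *)
Lemma ge0_le_integral_nonmeasurable (D : set T) (f g : T -> \bar R) :
  (forall x, D x -> 0 <= f x) -> (forall x, D x -> f x <= g x) ->
  \int[mu]_(x in D) f x <= \int[mu]_(x in D) g x.
Proof.
move=> f0 fg; rewrite !ge0_integralE//; last first.
  by move=> x Dx; apply: le_trans (fg x Dx); exact: f0.
apply: ge_ereal_sup => _ [h /= hf <-]; apply: ereal_sup_ubound; exists h => //= x.
apply: (le_trans (hf x)); rewrite /patch; case: ifPn => // /set_mem; exact: fg.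
Qed.

Lemma integral_le_cst (D : set T) (f : T -> R) (K : R) : measurable D ->
  (0 <= K)%R -> (forall x, D x -> (f x <= K)%R) ->
  \int[mu]_(x in D) (f x)%:E <= K%:E * mu D.
Proof.
move=> mD K0 fK; rewrite integralE -integral_cst//.
apply: (@le_trans _ _ (\int[mu]_(x in D) ((fun x => (f x)%:E) ^\+ x))).
  (* The negative part is discarded, even if its integral is infinite. *)
  rewrite -[leRHS]sube0; apply: leeB => //; exact: integral_ge0.
apply: ge0_le_integral_nonmeasurable => x Dx //.
by rewrite funeposE ge_max !lee_fin K0 fK.
Qed.

Lemma integral_ge_cst (D B : set T) (f : T -> R) (k : R) : measurable D ->
  measurable B -> B `<=` D ->
  (0 <= k)%R -> (forall x, D x -> (0 <= f x)%R) -> (forall x, B x -> (k <= f x)%R) ->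
  k%:E * mu B <= \int[mu]_(x in D) (f x)%:E.
Proof.
move=> mD mB BD k0 f0 kf; rewrite -{1}(setIidl BD) -integral_indic//.
have i0 x : D x -> 0 <= (\1_B x : R)%:E by move=> _; rewrite lee_fin.
have im : measurable_fun D (fun x => (\1_B x : R)%:E).
  exact/measurable_EFinP/measurable_indic.
rewrite -(ge0_integralZl_EFin mu mD i0 im k0).
apply: ge0_le_integral_nonmeasurable => x Dx; rewrite -EFinM lee_fin.
  by rewrite mulr_ge0.
rewrite indicE; have [xB|xB] := boolP (x \in B); last by rewrite mulr0 f0.
by rewrite mulr1; apply: kf; exact: set_mem.
Qed.

End IntegralBounds.

(** * Calculus and centring of the squared distance *)

Section SquaredDistance.
Context {R : realType} {N : nat}.
Local Notation E := 'rV[R]_N.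
Implicit Types (p x v : E).

Lemma differentiable_dotB p v x : differentiable (fun y : E => dot (y - p) v) x.
Proof.
have -> : (fun y : E => dot (y - p) v) = \sum_(i < N) (fun y : E => (y 0 i - p 0 i) * v 0 i).
  by apply/funext => y; rewrite fct_sumE; apply: eq_bigr => i _; rewrite !mxE.
apply: differentiable_sum => i.
apply: differentiableM => //.
by apply: differentiableB => //; exact: differentiable_coord.
Qed.

Lemma differentiable_sqdist p (c : R) x :
  differentiable (fun y : E => dot (y - p) (y - p) - c) x.
Proof.
apply: differentiableB => //.
have -> : (fun y : E => dot (y - p) (y - p)) =
    \sum_(i < N) (fun y : E => (y 0 i - p 0 i) * (y 0 i - p 0 i)).
  by apply/funext => y; rewrite fct_sumE; apply: eq_bigr => i _; rewrite !mxE.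
apply: differentiable_sum => i.
by apply: differentiableM; apply: differentiableB => //; exact: differentiable_coord.
Qed.

Lemma derive_sqdist p (c : R) x v :
  'D_v (fun y : E => dot (y - p) (y - p) - c) x = 2 * dot (x - p) v.
Proof.
apply: cvg_lim => //.
have h : 2 * dot (x - p) v + t * dot v v @[t --> (0 : R)^'] --> 2 * dot (x - p) v + 0 * dot v v.
  apply: cvgD; first exact: cvg_cst.
  by apply: cvgM; [exact: nbhs_dnbhs|exact: cvg_cst].
rewrite mul0r addr0 in h; apply: cvg_trans h; apply: near_eq_cvg.
near=> t => /=.
have t0 : t != 0 by near: t; exact: nbhs_dnbhs_neq.
rewrite -[t^-1 *: _]/(t^-1 * _)%R.
have -> : t *: v + x - p = t *: v + (x - p) by rewrite addrA.
have -> : dot (t *: v + (x - p)) (t *: v + (x - p)) =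
    t ^+ 2 * dot v v + 2 * t * dot (x - p) v + dot (x - p) (x - p).
  move: (x - p) => w; rewrite dotDl dotZl (dotC v) (dotC w (_ + _)) !dotDl !dotZl (dotC v w).
  by ring.
by field.
Unshelve. all: by end_near. Qed.

Lemma Ck1_sqdist p (c : R) : Ck 1 setT (fun y : E => dot (y - p) (y - p) - c).
Proof.
split=> [x _|v x _]; first exact: differentiable_sqdist.
have -> : 'D_v (fun y : E => dot (y - p) (y - p) - c) = fun y => 2 * dot (y - p) v.
  by apply/funext => y; exact: derive_sqdist.
apply: differentiable_continuous; apply: differentiableM => //.
exact: differentiable_dotB.
Qed.

Lemma grad_sqdist p (c : R) x :
  grad (fun y : E => dot (y - p) (y - p) - c) x = 2 *: (x - p).
Proof.
apply/rowP => i; rewrite mxE derive_sqdist [RHS]mxE; congr (_ * _).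
rewrite /dot (bigD1 i)//= big1 ?addr0; last first.
  by move=> j ji; rewrite [delta_mx _ _ _ _]mxE eqxx (negbTE ji) mulr0.
by rewrite [delta_mx _ _ _ _]mxE !eqxx mulr1.
Qed.

Lemma continuous_sqdist p : continuous (fun y : E => dot (y - p) (y - p)).
Proof.
have h : continuous (fun y : E => dot (y - p) (y - p) - 0).
  by move=> x; apply: differentiable_continuous; exact: differentiable_sqdist.
rewrite (_ : (fun y : E => dot (y - p) (y - p)) = fun y : E => dot (y - p) (y - p) - 0)//.
by apply/funext => y; rewrite subr0.
Qed.

Lemma continuous_hausdorff_measurable_fun d (D : set (caratheodory_type (@houter R N d)))
    (f : E -> R) : measurable D -> continuous f ->
  measurable_fun D (f : caratheodory_type (@houter R N d) -> R).
Proof.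
move=> mD cf; apply: (measurability _ (RGenOInfty.measurableE R)) => //= _ [_ [a ->] <-].
apply: measurableI => //; rewrite -[X in measurable X]setCK; apply: measurableC.
apply: closed_hausdorff_measurable; apply: open_closedC.
by apply: open_comp => // x _; exact: cf.
Qed.

Lemma hausdorff_set1 d p : hausdorff d.+1 [set p] = 0%E.
Proof.
apply/eqP; rewrite eq_le hausdorff_ge0 andbT; apply: ge_ereal_sup => _ [delta /= d0 <-].
apply: (le_trans (@hcontent_le_finite _ _ d.+1 delta unit [set p] (fun=> [set p]) _)).
  by move=> x; exists tt.
rewrite big_const card_unit /= adde0 /hgauge ifF; last by apply/negbTE/set0P; exists p.
have -> : diam [set p] = 0%E.
  apply/eqP; rewrite eq_le diam_ge0 ?andbT; last by exists p.
  apply: ge_ereal_sup => _ [[x y] [/= -> ->] <-] /=.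
  by rewrite subrr lee_fin /enorm /dot big1 ?sqrtr0// => i _; rewrite mxE mul0r.
have -> : (0 <= delta%:E)%E = true by rewrite lee_fin ltW.
by rewrite /= mul0r expr0n mulr0.
Qed.

(* The mean value of the squared distance to p over M; it vanishes only if M is
   negligible, in which case any constant will do. *)
Lemma exists_centering_constant d (M : set E) p : compact M ->
  (hausdorff d.+1 M < +oo)%E ->
  exists2 c : R, 0 < c &
    (\int[harea d.+1]_(x in M) (dot (x - p) (x - p) - c)%:E = 0)%E.
Proof.
move=> cM Mlty; set mu := harea d.+1.
pose MT : set (caratheodory_type (@houter R N d.+1)) := M.
have mM : measurable MT.
  by apply: closed_hausdorff_measurable; apply: compact_closed => //; exact: norm_hausdorff.
pose g (x : caratheodory_type (@houter R N d.+1)) : R := dot ((x : E) - p) ((x : E) - p).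
change (exists2 c : R, 0 < c & (\int[mu]_(x in MT) (g x - c)%:E = 0)%E).
have mg : measurable_fun MT g.
  by apply: continuous_hausdorff_measurable_fun => //; exact: continuous_sqdist.
have gb : [bounded g x | x in (M : set E)].
  have : compact ((g : E -> R) @` M).
    apply: continuous_compact => //; apply: continuous_subspaceT; exact: continuous_sqdist.
  move=> /compact_bounded[K [Kr hK]]; exists K; split=> // x /hK h y My; apply: h.
  by exists y.
have ig : mu.-integrable MT (EFin \o g) by exact: measurable_bounded_integrable.
have icst c : mu.-integrable MT (EFin \o cst c).
  apply: measurable_bounded_integrable => //; exists `|c|; split; first exact: num_real.
  by move=> r cr y _ /=; exact: ltW.
have intB c : (\int[mu]_(x in MT) (g x - c)%:E = \int[mu]_(x in MT) (g x)%:E - c%:E * mu MT)%E.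
  rewrite -integral_cst// -(integralB_EFin (f2 := cst c))//.
have [M0|M0] := eqVneq (mu MT) 0%E.
  exists 1; first by [].
  rewrite intB M0 mule0 sube0; apply: null_set_integral => //.
  exact/measurable_EFinP.
have Mfin : mu MT \is a fin_num by rewrite ge0_fin_numE// measure_ge0.
have Mgt0 : 0 < fine (mu MT) by rewrite fine_gt0// lt_neqAle eq_sym M0 measure_ge0.
have Ifin : (\int[mu]_(x in MT) (g x)%:E)%E \is a fin_num by exact: integrable_fin_num ig.
have g0 x : 0 <= g x by exact: dot_ge0.
have I0 : (\int[mu]_(x in MT) (g x)%:E)%E != 0%E.
  apply/eqP => Ieq0.
  have /ae_eq_integral_abs : (\int[mu]_(x in MT) `|(g x)%:E|)%E = 0%E.
    by rewrite -[RHS]Ieq0; apply: eq_integral => x _; rewrite gee0_abs// lee_fin.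
  have mgE : measurable_fun MT (EFin \o g) by exact/measurable_EFinP.
  move=> /(_ mM mgE)[Z [mZ Z0 hZ]].
  move/eqP : M0; apply; apply/eqP; rewrite eq_le measure_ge0 andbT.
  (* The squared distance vanishes only at [p], and a point has zero measure in positive
     dimension. *)
  have sub : (M : set E) `<=` [set p] `|` Z.
    move=> x Mx; have [->|xp] := eqVneq x p; [by left|right; apply: hZ => /= /(_ Mx)[gx0]].
    move/eqP : xp; apply; apply/eqP; rewrite -subr_eq0 -normr_le0.
    have := norm_le_enorm (x - p); rewrite /enorm.
    by have -> : dot (x - p) (x - p) = 0 by []; rewrite sqrtr0.
  apply: (le_trans (le_hausdorff d.+1 sub)).
  apply: (le_trans (outer_measureU2 (houter d.+1) _ _)).
  have -> : houter d.+1 Z = 0%E by exact: Z0.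
  have -> : houter d.+1 [set p] = 0%E by exact: hausdorff_set1.
  by rewrite adde0.
exists (fine (\int[mu]_(x in MT) (g x)%:E)%E / fine (mu MT)).
  have Ige0 : (0 <= \int[mu]_(x in MT) (g x)%:E)%E.
    by apply: integral_ge0 => x _; rewrite lee_fin.
  rewrite divr_gt0// fine_gt0// lt_neqAle eq_sym I0 Ige0 /=.
  by rewrite -ge0_fin_numE.
rewrite intB -[X in (_ * X)%E](fineK Mfin) -EFinM divfK ?gt_eqF// fineK//.
by rewrite subee.
Qed.

End SquaredDistance.

(** * Instability *)

Lemma convex_setI (R : realType) (V : lmodType R) (A B : set V) :
  convex_set A -> convex_set B -> convex_set (A `&` B).
Proof.
move=> cA cB x y l; rewrite !in_setI => /andP[Ax Bx] /andP[Ay By].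
by rewrite cA// cB.
Qed.

Lemma convex_ball0 (R : realType) (V : normedModType R) (r : R) :
  convex_set (ball (0 : V) r).
Proof.
apply/convex_setW => x y; rewrite !inE -!ball_normE /= !sub0r !normrN => xr yr l l0 l1.
rewrite inE /= sub0r normrN; apply: (le_lt_trans (ler_normD _ _)); rewrite !normrZ.
rewrite gtr0_norm// gtr0_norm ?subr_gt0//.
have -> : r = l%:num * r + (1 - l%:num) * r by ring.
by rewrite ltrD// ltr_pM2l// subr_gt0.
Qed.

Lemma convex_connected (R : realType) (V : normedModType R) (A : set V) :
  convex_set A -> connected A.
Proof.
move=> cA; have [->|/set0P[x0 Ax0]] := eqVneq A set0; first exact: connected0.
have -> : A = \bigcup_(x in A) ((fun t : R => x0 + t *: (x - x0)) @` `[0, 1]).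
  apply/seteqP; split=> [x Ax|_ [x Ax [t + <-]]].
    by exists x => //; exists 1; rewrite /= ?in_itv /= ?ler01 ?lexx// scale1r subrKC.
  by rewrite /= in_itv /= => /andP[t0 t1]; exact: convex_set_segment.
apply: bigcup_connected.
  exists x0 => x Ax; exists 0; last by rewrite scale0r addr0.
  by rewrite /= in_itv /= lexx ler01.
move=> x Ax; apply: connected_continuous_connected; first exact: segment_connected.
apply: continuous_subspaceT => t; apply: cvgD; first exact: cvg_cst.
by apply: cvgZ; [exact: cvg_id|exact: cvg_cst].
Qed.

(** * Truncation of the convex set by a ball *)

Section Bounding.
Context {R : realType} {n : nat}.
Local Notation E := 'rV[R]_n.+2.

Lemma partitioning_truncate (Omega Omega' M bM : set E) (r : R) :
  convex_set Omega -> partitioning Omega M bM ->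
  open Omega' -> convex_set Omega' -> M `\` bM `<=` Omega' -> bM `<=` bd Omega' ->
  M `<=` ball 0 r -> partitioning (Omega' `&` ball 0 r) M bM.
Proof.
move=> cO [[oO _ _ _] [MbM bM0] MO bMO [D1 [D2 ph]]] oO' cO' MO' bMO' Mr.
have [cM bMM _ _] := MbM.
have [x0 Mx0] := hypersurface_interior_nonempty MbM bM0.
have ob : open (ball (0 : E) r) by exact: ball_open.
have oI : open (Omega' `&` ball 0 r) by exact: openI.
have cI : convex_set (Omega' `&` ball 0 r) by apply: convex_setI => //; exact: convex_ball0.
have MI : M `\` bM `<=` Omega' `&` ball 0 r.
  by move=> x Mx; split; [exact: MO'|apply: Mr; case: Mx].
split=> //.
- split=> //; first exact: convex_connected.
    by exists x0; exact: MI.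
  exists r; split; first exact: num_real.
  move=> r' rr' x [_]; rewrite -ball_normE /= sub0r normrN => xr.
  exact/ltW/(lt_trans xr).
- by move=> x bx; apply/bd_setI_open => //; [exact/Mr/bMM|exact: bMO'].
apply: (transfer_phases cO oO cI oI (hypersurface_closed MbM) MO MI _ Mx0 ph).
(* [Omega'] is open, hence disjoint from its boundary, which contains [bM]. *)
apply/seteqP; split=> // x [bx [ox _]]; have [_] := bMO' x bx; apply.
by rewrite /interior; exact: open_nbhs_nbhs.
Qed.

Lemma second_form_sqnorm_ge0 (S : set E) (nu : E -> E) (p : E) :
  0 <= second_form_sqnorm S nu p.
Proof. by apply: sumr_ge0 => i _; apply: sumr_ge0 => j _; exact: sqr_ge0. Qed.

End Bounding.

Theorem proposition21 (R : realType) (n : nat)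
  (Omega M bM : set 'rV[R]_n.+2) (nu : 'rV[R]_n.+2 -> 'rV[R]_n.+2)
  (convex_Omega : convex_set Omega)
  (minimal_M : minimal_partitioning Omega M bM)
  (normal_nu : unit_normal_field M nu)
  (contact : exists sigma0 : R, forall sigma : R, sigma0 <= sigma ->
     exists Omega' : set 'rV[R]_n.+2,
       [/\ open Omega' /\ convex_set Omega',
           M `\` bM `<=` Omega',
           contacts_along Omega' Omega bM,
           forall p, bM p -> C2_hypersurface_at (bd Omega') p
         & forall p, bM p -> sigma <= II_bd Omega' p (nu p) (nu p)]) :
  exists Omega' : set 'rV[R]_n.+2,
    convex_set Omega' /\ unstable_partitioning Omega' M bM nu.
Proof.
have part := minimal_M.1; have [_ [MbM [p bp]] _ _ _] := part.
have [cM bMM _ _] := MbM.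
have Mlty := hausdorff_hypersurface_lty MbM.
have [c c0 cint] := exists_centering_constant p cM Mlty.
pose f (x : 'rV[R]_n.+2) : R := dot (x - p) (x - p) - c.
have [r r0 Mr] : exists2 r : R, 0 < r & M `<=` ball 0 r.
  have [r0 [_ hr]] := compact_bounded cM.
  exists (`|r0| + 2); first by rewrite ltr_wpDl.
  move=> x Mx; rewrite -ball_normE /= sub0r normrN.
  apply: (@le_lt_trans _ _ (`|r0| + 1)); last by rewrite ltrD2l ltr1n.
  by apply: hr => //; rewrite (le_lt_trans (ler_norm _))// ltrDl.
(* The gradient is [2 *: (x - p)]; two points of the ball are at sup distance at most [r + r], and
   the dimension converts to the Euclidean norm. *)
pose K : R := 4 * (n.+2%:R * (r + r) ^+ 2).
have K0 : 0 <= K by rewrite mulr_ge0// mulr_ge0// sqr_ge0.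
have gradK x : M x -> enorm (tproj (nu x) (grad f x)) ^+ 2 <= K.
  move=> Mx; have [nu1 _] := normal_nu.2 x Mx.
  apply: (le_trans (enorm_tproj _ nu1)); rewrite grad_sqdist dotZl dotC dotZl mulrA.
  have -> : (2 * 2 : R) = 4 by ring.
  rewrite ler_pM2l//; apply: (le_trans (dot_le_norm _)); rewrite ler_pM2l//.
  rewrite lerXn2r ?nnegrE//; first by rewrite addr_ge0// ltW.
  apply: (le_trans (ler_normB _ _)); apply: lerD.
    by have := Mr x Mx; rewrite -ball_normE /= sub0r normrN; exact: ltW.
  by have := Mr p (bMM p bp); rewrite -ball_normE /= sub0r normrN; exact: ltW.
pose A : R := K * fine (hausdorff n.+1 M).
have A0 : 0 <= A by rewrite mulr_ge0// fine_ge0// hausdorff_ge0.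
(* On [B] one has [f <= - (c / 2)], hence [f ^+ 2 >= k]. The large inequality makes [B] closed, thus
   measurable; its positive measure comes from the strict, open version. *)
pose B : set 'rV[R]_n.+2 := bM `&` [set x | dot (x - p) (x - p) <= c / 2].
have clbM := hypersurface_boundary_closed MbM.
have clB : closed B.
  apply: (closedI clbM).
  refine (@preimage_closed _ _ (fun x : 'rV[R]_n.+2 => dot (x - p) (x - p))
    [set y : R | y <= c / 2] _ _); last exact: closed_le.
  by move=> x _; exact: continuous_sqdist.
have B0 : (0 < hausdorff n B)%E.
  pose W := [set x : 'rV[R]_n.+2 | dot (x - p) (x - p) < c / 2].
  have oW : open W.
    refine (@open_comp _ _ (fun x : 'rV[R]_n.+2 => dot (x - p) (x - p))
      [set y : R | y < c / 2] _ _); last exact: open_lt.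
    by move=> x _; exact: continuous_sqdist.
  apply: (lt_le_trans (hausdorff_boundary_gt0 MbM bp oW _)).
    rewrite /W /= subrr /dot big1; first exact: divr_gt0.
    by move=> i _; rewrite mxE mul0r.
  by apply: le_hausdorff => x [bx Wx]; split=> //; exact: ltW.
(* The measure of [B] may be infinite a priori; a positive real below it is all that is used. *)
have [b b0 bB] : exists2 b : R, 0 < b & (b%:E <= hausdorff n B)%E.
  case: (hausdorff n B) B0 => [b b0|_|//]; first by exists b.
  by exists 1 => //; rewrite leey.
pose k : R := (c / 2) ^+ 2.
have k0 : 0 < k by rewrite exprn_gt0// divr_gt0.
have [sigma0 hs] := contact.
(* Gives [A + 1 <= sigma * (k * b)]; the 1 makes the final inequality strict, and makes [sigma]
   positive even if [A = 0]. *)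
pose sigma : R := Num.max sigma0 ((A + 1) / (k * b)).
have sA : (A + 1) / (k * b) <= sigma by rewrite le_max lexx orbT.
have sigma_gt0 : 0 < sigma.
  by apply: lt_le_trans sA; rewrite divr_gt0 ?mulr_gt0// ltr_wpDl.
have [|Omega' [[oO' cO'] MO' [bMO' _ _] C2 II]] := hs sigma.
  by rewrite le_max lexx.
have oW : open (ball (0 : 'rV[R]_n.+2) r) by exact: ball_open.
exists (Omega' `&` ball 0 r); split.
  by apply: convex_setI => //; exact: convex_ball0.
split.
- exact: (partitioning_truncate convex_Omega part).
- move=> q bq; have Wq : ball 0 r q by exact/Mr/bMM.
  apply: (C2_hypersurface_at_local oW Wq _ (C2 q bq)) => x Wx.
  by have := bd_setI_open Omega' oW Wx; tauto.
exists f; first by split=> //; exact: Ck1_sqdist.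
rewrite /second_variation; set I1 := (X in (X - _)%E); set I2 := (X in (_ - X)%E).
have I1A : (I1 <= A%:E)%E.
  rewrite /A EFinM fineK; last by rewrite ge0_fin_numE ?hausdorff_ge0.
  apply: integral_le_cst => //.
    exact/closed_hausdorff_measurable/(hypersurface_closed MbM).
  move=> x Mx; rewrite lerBlDr; apply: (le_trans (gradK x Mx)).
  by rewrite lerDl mulr_ge0 ?second_form_sqnorm_ge0 ?sqr_ge0.
have IIx x : bM x -> sigma <= II_bd (Omega' `&` ball 0 r) x (nu x) (nu x).
  by move=> bx; rewrite II_bd_setI_open//; [exact: II|exact/Mr/bMM].
have I2B : ((sigma * k)%:E * hausdorff n B <= I2)%E.
  apply: integral_ge_cst.
  - exact: closed_hausdorff_measurable.
  - exact: closed_hausdorff_measurable.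
  - by move=> x [].
  - by rewrite mulr_ge0// ltW.
  - by move=> x bx; rewrite mulr_ge0 ?sqr_ge0// (le_trans _ (IIx x bx))// ltW.
  - move=> x [bx /= xc]; apply: ler_pM => //.
    + exact: ltW.
    + exact: ltW.
    + exact: IIx.
    + rewrite /k -[leRHS]sqrrN lerXn2r ?nnegrE /f //; lra.
have AI2 : (A%:E < I2)%E.
  apply: lt_le_trans I2B; apply: (@lt_le_trans _ _ ((sigma * k)%:E * b%:E)%E).
    rewrite -EFinM lte_fin -mulrA (@lt_le_trans _ _ (A + 1))//; first by rewrite ltrDl.
    by rewrite -ler_pdivrMr// mulr_gt0.
  by rewrite lee_pmul2l// lte_fin mulr_gt0.
(* The boundary integral may be infinite; the second variation is then [-oo], which is still
   negative. *)
have : (I1 < I2)%E by exact: le_lt_trans AI2.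
case: (I2) AI2 => [i2 _ h| _ _|//]; last by rewrite addeNy.
by rewrite lteBlDr// add0e.
Qed.
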